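(* Let $U$ be Haar-distributed on $\mathcal{U}(d)$. Then (i) for odd $d$, with single-qudit displacement operators ($n=1$, $d_L=d$): $\mathbb{E}_U[H_2(U)]=1-\frac{3(d^4-4d^2+2)}{d^4(d^2-4)}$; (ii) for even $d$, with single-qudit displacement operators ($n=1$, $d_L=d$): $\mathbb{E}_U[H_2(U)]=1-\frac{3(d^4-10d^2+10)}{d^2(d^2-9)(d^2-1)}$; (iii) for $d=2^n$ with $n$-qubit displacement operators ($d_L=2$): $\mathbb{E}_U[H_2(U)]=1-\frac{4(d^4-9d^2+6)}{d^4(d^2-9)}$. In particular $\mathbb{E}_U[H_2(U)]=1-O(1/d^2)$.
   Context: On $\mathbb{C}^{d_L}$ let $Z|k\rangle=\omega^k|k\rangle$, $X|k\rangle=|k+1\rangle$ (mod $d_L$), $\omega=e^{2\pi i/d_L}$, $\tau=-e^{i\pi/d_L}$, $D_{(a_1,a_2)}=\tau^{a_1a_2}X^{a_1}Z^{a_2}$, and for $\mathbf a=\mathbf a_1\oplus\cdots\oplus\mathbf a_n\in\mathbb{Z}_{d_L}^{2n}$ let $D_{\mathbf a}=D_{\mathbf a_1}\otimes\cdots\otimes D_{\mathbf a_n}$ acting on $\mathbb{C}^d$, $d=d_L^n$. The 2-Clifford entropy of a unitary $U$ is $H_2(U)=1-\frac{1}{d^6}\sum_{\mathbf a,\mathbf b}\big|\operatorname{tr}(D_{\mathbf a}^\dagger UD_{\mathbf b}U^\dagger)\big|^4$. *)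

(* Defs.v *)
From HB Require Import structures.
From mathcomp Require Import all_boot all_order all_algebra.
From mathcomp Require Import complex.
From mathcomp Require Import all_classical all_reals all_analysis.
Set Implicit Arguments. Unset Strict Implicit. Unset Printing Implicit Defensive.
Import Order.TTheory GRing.Theory Num.Theory numFieldNormedType.Exports.
Local Open Scope ring_scope.
Local Open Scope complex_scope.

Section Defs.
Variable R : realType.
Local Notation C := R[i].

Definition expi (t : R) : C := cos t +i* sin t.
Definition conjC (z : C) : C := @complex.Re R z -i* @complex.Im R z.
Definition abs4 (z : C) : R := (@complex.Re R z ^+ 2 + @complex.Im R z ^+ 2) ^+ 2.

Definition adj {m n} (A : 'M[C]_(m, n)) : 'M[C]_(n, m) := map_mx conjC A^T.
Definition unitary {d} (U : 'M[C]_d) : bool := U *m adj U == 1%:M.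
Definition mxpow {d} (A : 'M[C]_d) (k : nat) : 'M[C]_d := iter k (mulmx A) 1%:M.

Definition omega dL : C := expi (2 * pi / dL%:R).
Definition tau dL : C := - expi (pi / dL%:R).
Definition Zop dL : 'M[C]_dL := \matrix_(i, j) ((i == j)%:R * omega dL ^+ j).
Definition Xop dL : 'M[C]_dL := \matrix_(i < dL, j < dL) ((val i == (val j).+1 %% dL)%N)%:R.
Definition disp dL (a : 'I_dL * 'I_dL) : 'M[C]_dL :=
  tau dL ^+ (val a.1 * val a.2) *: (mxpow (Xop dL) a.1 *m mxpow (Zop dL) a.2).

(* n-qubit displacement operators: tensor product of single-qubit ones *)
Definition bit n (k : nat) (i : 'I_(2 ^ n)) : 'I_2 := inord (i %/ 2 ^ k %% 2).
Definition dispn n (a : {ffun 'I_n -> 'I_2 * 'I_2}) : 'M[C]_(2 ^ n) :=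
  \matrix_(i, j) \prod_(k < n) disp (a k) (bit k i) (bit k j).

Definition H2 {d} (I : finType) (D : I -> 'M[C]_d) (U : 'M[C]_d) : R :=
  1 - (d%:R ^+ 6)^-1 * \sum_(a : I) \sum_(b : I)
        abs4 (\tr (adj (D a) *m U *m D b *m adj U)).

Definition reim {d} (A : 'M[C]_d) : 'M[R]_d * 'M[R]_d :=
  (map_mx (@complex.Re R) A, map_mx (@complex.Im R) A).

Definition haar_random {d} {dsp} {T : measurableType dsp}
    (P : probability T R) (U : T -> 'M[C]_d) : Prop :=
  [/\ forall i j, measurable_fun setT (fun t => @complex.Re R (U t i j)) /\
                  measurable_fun setT (fun t => @complex.Im R (U t i j)),
      forall t, unitary (U t) &
      forall V : 'M[C]_d, unitary V ->
        forall f : 'M[R]_d * 'M[R]_d -> R, continuous f ->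
          (\int[P]_t (f (reim (V *m U t)))%:E = \int[P]_t (f (reim (U t)))%:E)%E].

End Defs.

(* Main.v *)
(** Put W = U B U^-1 for a displacement operator B. Left invariance of U makes the law of W
invariant under conjugation, so a traceless unitary A may be replaced by the diagonal matrix of its
eigenvalues l_i, and E |tr (A^-1 W)|^4 is the contraction of l with the tensor
T_ijkl = E [w_i conj(w_j) w_k conj(w_l)], where w_i = W_ii. This tensor is invariant under
permutations of 'I_d and vanishes when summed over one index, so it is determined by three numbers:
E |w_1|^4, E |w_1|^2 |w_2|^2 and E [w_1^2 conj(w_2)^2]. Differentiating the invariance along the
elementary matrices E_ji and summing over j gives, for M_k = U B_k U^-1 and (1,1) entries,
  (d + 3) E [M_1 M_2 M_3 M_4] = tr B_4 E [M_1 M_2 M_3] + sum_k E [(M_k M_4) prod_(l <> k) M_l],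
and a similar relation for two indices. With tr W = 0 and either tr W^2 = 0 or W^2 scalar, these
relations yield the three numbers. The square of a displacement operator D_a is scalar if 2a = 0
mod d_L and traceless otherwise, so the entropy follows by counting 2-torsion points. *)
Require Import Defs.
From HB Require Import structures.
From mathcomp Require Import all_boot all_order all_algebra.
From mathcomp Require Import complex.
From mathcomp Require Import all_classical all_reals all_analysis.
From mathcomp Require Import measurable_realfun fingroup perm ring.
Set Implicit Arguments.
Unset Strict Implicit.
Unset Printing Implicit Defensive.
Import Order.TTheory GRing.Theory Num.Theory numFieldNormedType.Exports.
Local Open Scope ring_scope.

(** * Adjoints and unitary matrices *)

(** Left invariance only provides unitary rotations, hence derivatives along antihermitian
    directions, whereas the sums over j collapse to products and traces only along elementary
    matrices. The gap is closed by complex linearity: conjugated entries are written as entries of U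
    B^-1 U^-1, so the derivative of a product of entries is complex-linear in the direction and
    vanishes along every E_ji with i <> j. The eigenvalues of A have modulus one and sum to zero, so
    among the fifteen coincidence patterns of T only those without an isolated index survive the
    contraction, and A enters through d and |tr A^2|^2 alone. The same dichotomy on squares thus
    governs A and B, whence the values [val_hh], [val_gh], [val_gg]. The identity is kept apart: an
    overlap with it is a trace, which gives d^4 against itself and 0 otherwise. Small dimensions
    shape the statements. Filling in the values of T divides successively by d - 1, d - 2 and d - 3,
    so bounds on d are demanded only where operators of the relevant type exist, and d = 2 and d = 3
    rely on the default value of division by zero. *)

Section Adjoint.
Variable R : realType.
Local Notation C := R[i].

Lemma Defs_conjCE (z : C) : Defs.conjC z = z^*.
Proof. by case: z. Qed.

Lemma adjE m n (A : 'M[C]_(m, n)) i j : adj A i j = (A j i)^*.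
Proof. by rewrite !mxE Defs_conjCE. Qed.

Lemma adjK m n (A : 'M[C]_(m, n)) : adj (adj A) = A.
Proof. by apply/matrixP=> i j; rewrite !adjE conjCK. Qed.

Lemma adj_mul m n p (A : 'M[C]_(m, n)) (B : 'M[C]_(n, p)) :
  adj (A *m B) = adj B *m adj A.
Proof.
apply/matrixP=> i j; rewrite adjE !mxE rmorph_sum /=; apply: eq_bigr=> k _.
by rewrite !adjE rmorphM mulrC.
Qed.

Lemma adj_scale m n (c : C) (A : 'M[C]_(m, n)) : adj (c *: A) = c^* *: adj A.
Proof. by apply/matrixP=> i j; rewrite !(adjE, mxE) rmorphM. Qed.

Lemma adj1 n : adj (1%:M : 'M[C]_n) = 1%:M.
Proof. by apply/matrixP=> i j; rewrite adjE !mxE eq_sym rmorph_nat. Qed.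

Lemma mxtrace_adj n (A : 'M[C]_n) : \tr (adj A) = (\tr A)^*.
Proof. by rewrite /mxtrace rmorph_sum; apply: eq_bigr=> i _; rewrite adjE. Qed.

Lemma unitaryP n (U : 'M[C]_n) : unitary U -> U *m adj U = 1%:M.
Proof. by move/eqP. Qed.

Lemma unitaryPV n (U : 'M[C]_n) : unitary U -> adj U *m U = 1%:M.
Proof. by move/unitaryP/mulmx1C. Qed.

Lemma unitary_perm n (s : {perm 'I_n}) : unitary (perm_mx s : 'M[C]_n).
Proof.
apply/eqP; suff -> : adj (perm_mx s : 'M[C]_n) = perm_mx s^-1%g.
  by rewrite -perm_mxM mulgV perm_mx1.
by rewrite -tr_perm_mx; apply/matrixP=> i j; rewrite adjE !mxE rmorph_nat.
Qed.

Lemma unitary_entry n (U : 'M[C]_n) i j : unitary U -> `|U i j| <= 1.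
Proof.
move=> /unitaryP /matrixP /(_ i i); rewrite !mxE eqxx mulr1n => h.
rewrite -(@expr_le1 _ 2) // -h (bigD1 j) //= adjE normCK lerDl sumr_ge0 // => k _.
by rewrite adjE -normCK exprn_ge0.
Qed.

Lemma unitary_spectral n (A : 'M[C]_n) : unitary A ->
  exists S l, [/\ unitary S, forall i, l i * (l i)^* = 1 &
     A = adj S *m diag_mx (\row_i l i) *m S].
Proof.
move=> uA.
have tE (B : 'M[C]_n) : map_mx Num.conj B^T = adj B.
  by apply/matrixP=> i j; rewrite adjE !mxE.
have : A \is normalmx by rewrite qualifE /= tE unitaryP // unitaryPV.
move=> /orthomx_spectralP; set S := spectralmx A; set l := spectral_diag A => AE.
have uS : unitary S.
  have /unitarymxP := spectral_unitarymx A; rewrite tE => h; exact/eqP.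
have Si : invmx S = adj S by rewrite invmx_unitary ?spectral_unitarymx // tE.
have lE : diag_mx l = S *m A *m adj S.
  by rewrite AE Si !mulmxA unitaryP // mul1mx -mulmxA unitaryP // mulmx1.
exists S, (fun i => l 0 i); split; [exact: uS | move=> i | ]; last first.
  by rewrite {1}AE Si; congr (_ *m diag_mx _ *m _); apply/rowP=> i; rewrite mxE.
(* The diagonal form is unitarily conjugate to [A], hence unitary, so each eigenvalue has modulus
   one. *)
have : diag_mx l *m adj (diag_mx l) = 1%:M.
  rewrite lE !adj_mul adjK !mulmxA -(mulmxA (S *m A)) unitaryPV // mulmx1.
  by rewrite -(mulmxA S) unitaryP // mulmx1 unitaryP.
move=> /matrixP /(_ i i); by rewrite mul_diag_mx mxE adjE !mxE eqxx !mulr1n => ->.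
Qed.

End Adjoint.

(** * Expectation of bounded complex random variables *)

Section Expectation.
Variables (R : realType) (dsp : measure_display) (T : measurableType dsp).
Variable P : probability T R.
Local Notation C := R[i].

(** On a probability space boundedness gives integrability, and it is also stable under products, so
    every polynomial in the entries of [U] and their conjugates is covered. *)
Definition bounded_rv (f : T -> C) : Prop :=
  [/\ measurable_fun setT (fun t => complex.Re (f t)),
      measurable_fun setT (fun t => complex.Im (f t)) &
      exists M : R, forall t, `|f t| <= M%:C%C].

Definition esp (f : T -> C) : C :=
  Complex (\int[P]_t complex.Re (f t)) (\int[P]_t complex.Im (f t)).

Lemma complexReD (x y : C) : complex.Re (x + y) = complex.Re x + complex.Re y.
Proof. by case: x y => ? ? []. Qed.

Lemma complexImD (x y : C) : complex.Im (x + y) = complex.Im x + complex.Im y.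
Proof. by case: x y => ? ? []. Qed.

Lemma complexReM (x y : C) : complex.Re (x * y) =
  complex.Re x * complex.Re y - complex.Im x * complex.Im y.
Proof. by case: x y => ? ? []. Qed.

Lemma complexImM (x y : C) : complex.Im (x * y) =
  complex.Re x * complex.Im y + complex.Im x * complex.Re y.
Proof. by case: x y => ? ? []. Qed.

Lemma complexRe_conj (x : C) : complex.Re x^* = complex.Re x.
Proof. by case: x. Qed.

Lemma complexIm_conj (x : C) : complex.Im x^* = - complex.Im x.
Proof. by case: x. Qed.

Lemma Re_le_norm (x : C) (M : R) : `|x| <= M%:C%C -> `|complex.Re x| <= M.
Proof. by move=> h; rewrite -lecR; apply: le_trans h; exact: normc_ge_Re. Qed.

Lemma Im_le_norm (x : C) (M : R) : `|x| <= M%:C%C -> `|complex.Im x| <= M.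
Proof.
(* Multiplication by i turns minus the imaginary part into a real part and keeps the modulus. *)
move=> h; rewrite -normrN -ReiNIm; apply: Re_le_norm.
rewrite normrM (normc_def (Complex 0 1)) /=. by rewrite expr0n expr1n add0r sqrtr1 mulr1.
Qed.

Lemma bounded_rv_cst c : bounded_rv (fun=> c).
Proof.
split; try exact: measurable_cst.
by exists (complex.Re `|c|) => _; rewrite RRe_real.
Qed.

Lemma bounded_rvD f g :
  bounded_rv f -> bounded_rv g -> bounded_rv (fun t => f t + g t).
Proof.
move=> [f1 f2 [M fM]] [g1 g2 [N gN]]; split.
- by under eq_fun do rewrite complexReD; exact: measurable_funD.
- by under eq_fun do rewrite complexImD; exact: measurable_funD.
- exists (M + N) => t; rewrite rmorphD /=.
  by apply: le_trans (ler_normD _ _) _; exact: lerD.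
Qed.

Lemma bounded_rvM f g :
  bounded_rv f -> bounded_rv g -> bounded_rv (fun t => f t * g t).
Proof.
move=> [f1 f2 [M fM]] [g1 g2 [N gN]]; split.
- under eq_fun do rewrite complexReM.
  by apply: measurable_funB; apply: measurable_funM.
- under eq_fun do rewrite complexImM.
  by apply: measurable_funD; apply: measurable_funM.
- by exists (M * N) => t; rewrite rmorphM /= normrM; exact: ler_pM.
Qed.

Lemma bounded_rv_conj f : bounded_rv f -> bounded_rv (fun t => (f t)^*).
Proof.
move=> [f1 f2 [M fM]]; split.
- by under eq_fun do rewrite complexRe_conj.
- by under eq_fun do rewrite complexIm_conj; exact: measurable_funN.
- by exists M => t; rewrite norm_conjC.
Qed.

Lemma bounded_rv_sum (I : Type) (r : seq I) (Q : pred I) (F : I -> T -> C) :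
  (forall i, Q i -> bounded_rv (F i)) ->
  bounded_rv (fun t => \sum_(i <- r | Q i) F i t).
Proof.
move=> h; elim: r => [|i r IH].
  by under eq_fun do rewrite big_nil; exact: bounded_rv_cst.
case Qi: (Q i); under eq_fun do rewrite big_cons Qi; last by [].
by apply: bounded_rvD => //; exact: h.
Qed.

Lemma bounded_rv_integrable f : bounded_rv f ->
  P.-integrable setT (EFin \o (fun t => complex.Re (f t))) /\
  P.-integrable setT (EFin \o (fun t => complex.Im (f t))).
Proof.
have h (g : T -> R) : measurable_fun setT g -> (exists M, forall t, `|g t| <= M) ->
    P.-integrable setT (EFin \o g).
  move=> mg [M gM]; apply: measurable_bounded_integrable => //.
    by rewrite [X in (X < _)%E]probability_setT ltry.
  exists M; split; first exact: num_real.
  by move=> r Mr t _ /=; apply: le_trans (gM t) _; exact: ltW.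
move=> [f1 f2 [M fM]]; split; apply: h => //; exists M => t.
  exact: Re_le_norm.
exact: Im_le_norm.
Qed.

Lemma eq_esp f g : f =1 g -> esp f = esp g.
Proof. by move=> /funext ->. Qed.

Lemma esp_cst c : esp (fun=> c) = c.
Proof.
rewrite /esp !Rintegral_cst //.
have -> : fine (P setT) = 1 by rewrite probability_setT.
by rewrite !mulr1; case: c.
Qed.

Lemma espD f g : bounded_rv f -> bounded_rv g ->
  esp (fun t => f t + g t) = esp f + esp g.
Proof.
move=> /bounded_rv_integrable [f1 f2] /bounded_rv_integrable [g1 g2].
rewrite /esp; under eq_Rintegral do rewrite complexReD.
by under [X in Complex _ X]eq_Rintegral do rewrite complexImD; rewrite !RintegralD.
Qed.

Lemma espZ c f : bounded_rv f -> esp (fun t => c * f t) = c * esp f.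
Proof.
move=> /bounded_rv_integrable [f1 f2]; have ZI (r : R) (g : T -> R) :
    P.-integrable setT (EFin \o g) -> P.-integrable setT (EFin \o (fun t => r * g t)).
  by move=> ig; exact: (integrableZl measurableT r ig).
rewrite /esp; under eq_Rintegral do rewrite complexReM.
under [X in Complex _ X]eq_Rintegral do rewrite complexImM.
rewrite RintegralB ?RintegralD ?RintegralZl //; try exact: ZI.
by case: c.
Qed.

Lemma esp_sum (I : Type) (r : seq I) (Q : pred I) (F : I -> T -> C) :
  (forall i, Q i -> bounded_rv (F i)) ->
  esp (fun t => \sum_(i <- r | Q i) F i t) = \sum_(i <- r | Q i) esp (F i).
Proof.
move=> h; elim: r => [|i r IH].
  by rewrite big_nil -[RHS]esp_cst; apply: eq_esp => t; rewrite big_nil.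
rewrite big_cons; case: ifP => Qi; last first.
  by rewrite -IH; apply: eq_esp => t; rewrite big_cons Qi.
rewrite -IH -espD; first by apply: eq_esp => t; rewrite big_cons Qi.
  exact: h.
exact: bounded_rv_sum.
Qed.

(** Links the extended-real integral of the theorem to [esp], where linearity is available;
    boundedness makes the integral finite, so [fine] loses nothing. *)
Lemma integral_Re f : bounded_rv f ->
  (\int[P]_t (complex.Re (f t))%:E)%E = (complex.Re (esp f))%:E.
Proof.
move=> /bounded_rv_integrable [f1 _].
by rewrite /esp /Rintegral /= fineK //; exact: integrable_fin_num.
Qed.

End Expectation.

(** * Bounded random matrices *)

Section BoundedMatrix.
Variables (R : realType) (dsp : measure_display) (T : measurableType dsp).
Local Notation C := R[i].

Lemma bounded_rvZ (c : C) (f : T -> C) : bounded_rv f -> bounded_rv (fun t => c * f t).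
Proof. by move=> bf; apply: bounded_rvM => //; exact: bounded_rv_cst. Qed.

Lemma bounded_rvN (f : T -> C) : bounded_rv f -> bounded_rv (fun t => - f t).
Proof. by move=> bf; under eq_fun do rewrite -mulN1r; exact: bounded_rvZ. Qed.

Definition bounded_rmx m n (M : T -> 'M[C]_(m, n)) :=
  forall a b, bounded_rv (fun t => M t a b).

Lemma bounded_rmx_cst m n (A : 'M[C]_(m, n)) : bounded_rmx (fun=> A).
Proof. by move=> a b; exact: bounded_rv_cst. Qed.

Lemma bounded_rmxD m n (M N : T -> 'M[C]_(m, n)) :
  bounded_rmx M -> bounded_rmx N -> bounded_rmx (fun t => M t + N t).
Proof.
by move=> bM bN a b; under eq_fun do rewrite mxE; apply: bounded_rvD; [exact: bM | exact: bN].
Qed.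

Lemma bounded_rmxN m n (M : T -> 'M[C]_(m, n)) :
  bounded_rmx M -> bounded_rmx (fun t => - M t).
Proof. by move=> bM a b; under eq_fun do rewrite mxE; apply: bounded_rvN; exact: bM. Qed.

Lemma bounded_rmxZ m n c (M : T -> 'M[C]_(m, n)) :
  bounded_rmx M -> bounded_rmx (fun t => c *: M t).
Proof. by move=> bM a b; under eq_fun do rewrite mxE; apply: bounded_rvZ; exact: bM. Qed.

Lemma bounded_rmxM m n p (M : T -> 'M[C]_(m, n)) (N : T -> 'M[C]_(n, p)) :
  bounded_rmx M -> bounded_rmx N -> bounded_rmx (fun t => M t *m N t).
Proof.
move=> bM bN a b; under eq_fun do rewrite mxE; apply: bounded_rv_sum => k _.
by apply: bounded_rvM; [exact: bM | exact: bN].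
Qed.

Lemma bounded_rmx_adj m n (M : T -> 'M[C]_(m, n)) :
  bounded_rmx M -> bounded_rmx (fun t => adj (M t)).
Proof.
by move=> bM a b; under eq_fun do rewrite adjE; apply: bounded_rv_conj; exact: bM.
Qed.

End BoundedMatrix.

(** * Invariance of the law of U B U^-1 *)

Section HaarInvariance.
Variables (R : realType) (d : nat) (dsp : measure_display).
Variables (T : measurableType dsp) (P : probability T R) (U : T -> 'M[R[i]]_d).
Hypothesis haarU : haar_random P U.
Local Notation C := R[i].

Let pairs := ('M[R]_d * 'M[R]_d)%type.

(** Composing a function of a complex matrix with this left inverse of [reim] yields a function on
    the pairs that [haar_random] tests. *)
Definition of_reim (p : pairs) : 'M[C]_d := \matrix_(i, j) Complex (p.1 i j) (p.2 i j).

Lemma reimK (A : 'M[C]_d) : of_reim (reim A) = A.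
Proof. by apply/matrixP=> i j; rewrite !mxE /=; case: (A i j). Qed.

Definition ccont (f : pairs -> C) : Prop :=
  continuous (fun p => complex.Re (f p)) /\ continuous (fun p => complex.Im (f p)).

Lemma ccont_cst c : ccont (fun=> c).
Proof. by split=> p; exact: cvg_cst. Qed.

Lemma ccontD f g : ccont f -> ccont g -> ccont (fun p => f p + g p).
Proof.
move=> [f1 f2] [g1 g2]; split.
- by under eq_fun do rewrite complexReD; move=> p; apply: cvgD; [exact: f1 | exact: g1].
- by under eq_fun do rewrite complexImD; move=> p; apply: cvgD; [exact: f2 | exact: g2].
Qed.

Lemma ccontM f g : ccont f -> ccont g -> ccont (fun p => f p * g p).
Proof.
move=> [f1 f2] [g1 g2]; split.
- under eq_fun do rewrite complexReM; move=> p.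
  by apply: cvgB; apply: cvgM; [exact: f1 | exact: g1 | exact: f2 | exact: g2].
- under eq_fun do rewrite complexImM; move=> p.
  by apply: cvgD; apply: cvgM; [exact: f1 | exact: g2 | exact: f2 | exact: g1].
Qed.

Lemma ccont_conj f : ccont f -> ccont (fun p => (f p)^*).
Proof.
move=> [f1 f2]; split; first by under eq_fun do rewrite complexRe_conj.
by under eq_fun do rewrite complexIm_conj; move=> p; apply: cvgN; exact: f2.
Qed.

Lemma ccont_sum (I : Type) (r : seq I) (F : I -> pairs -> C) :
  (forall i, ccont (F i)) -> ccont (fun p => \sum_(i <- r) F i p).
Proof.
move=> h; elim: r => [|i r IH].
  by under eq_fun do rewrite big_nil; exact: ccont_cst.
by under eq_fun do rewrite big_cons; apply: ccontD.
Qed.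

Lemma ccont_entry i j : ccont (fun p => of_reim p i j).
Proof.
split; under eq_fun do rewrite mxE /=; move=> p.
- apply: (@continuous_comp _ _ _ fst (fun M : 'M[R]_d => M i j)); first exact: cvg_fst.
  exact: coord_continuous.
- apply: (@continuous_comp _ _ _ snd (fun M : 'M[R]_d => M i j)); first exact: cvg_snd.
  exact: coord_continuous.
Qed.

Lemma ccont_conjugate B a b :
  ccont (fun p => (of_reim p *m B *m adj (of_reim p)) a b).
Proof.
under eq_fun do rewrite mxE; apply: ccont_sum => j; apply: ccontM; last first.
  by under eq_fun do rewrite adjE; apply: ccont_conj; exact: ccont_entry.
under eq_fun do rewrite mxE; apply: ccont_sum => k; apply: ccontM.
  exact: ccont_entry.
exact: ccont_cst.
Qed.

Lemma esp_haar (f : 'M[C]_d -> C) V : ccont (fun p => f (of_reim p)) -> unitary V ->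
  esp P (fun t => f (V *m U t)) = esp P (fun t => f (U t)).
Proof.
case: haarU => _ _ inv [fr fi] uV.
have h (g : pairs -> R) : continuous g ->
    fine (\int[P]_t (g (reim (V *m U t)))%:E) = fine (\int[P]_t (g (reim (U t)))%:E).
  by move=> cg; rewrite (inv V uV g cg).
transitivity (esp P (fun t => f (of_reim (reim (V *m U t))))).
  by apply: eq_esp => t; rewrite reimK.
transitivity (esp P (fun t => f (of_reim (reim (U t))))); last first.
  by apply: eq_esp => t; rewrite reimK.
by rewrite /esp /Rintegral; congr Complex; [exact: (h _ fr) | exact: (h _ fi)].
Qed.

Definition conjby B t := U t *m B *m adj (U t).

Lemma haar_unitary t : unitary (U t).
Proof. by case: haarU. Qed.

Lemma conjbyM B1 B2 t : conjby B1 t *m conjby B2 t = conjby (B1 *m B2) t.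
Proof.
rewrite /conjby !mulmxA; congr (_ *m _ *m _).
by rewrite -mulmxA unitaryPV ?mulmx1 //; exact: haar_unitary.
Qed.

Lemma conjby1 t : conjby 1%:M t = 1%:M.
Proof. by rewrite /conjby mulmx1 unitaryP //; exact: haar_unitary. Qed.

Lemma conjbyZ c B t : conjby (c *: B) t = c *: conjby B t.
Proof. by rewrite /conjby -scalemxAr -scalemxAl. Qed.

Lemma adj_conjby B t : adj (conjby B t) = conjby (adj B) t.
Proof. by rewrite /conjby !adj_mul adjK mulmxA. Qed.

Lemma tr_conjby B t : \tr (conjby B t) = \tr B.
Proof.
by rewrite /conjby mxtrace_mulC mulmxA unitaryPV ?mul1mx //; exact: haar_unitary.
Qed.

Lemma bounded_haar : bounded_rmx U.
Proof.
by case: haarU => mU uU _ i j; case: (mU i j); split=> //; exists 1 => t; exact: unitary_entry.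
Qed.

Lemma bounded_conjby B : bounded_rmx (conjby B).
Proof.
apply: bounded_rmxM; last by apply: bounded_rmx_adj; exact: bounded_haar.
by apply: bounded_rmxM; [exact: bounded_haar | exact: bounded_rmx_cst].
Qed.

(** Replacing [U] by V U turns U B U^-1 into V (U B U^-1) V^-1. Conjugated entries are included,
    since they are entries of [conjby U (adj B)]. *)
Lemma esp_conjby_inv V B1 B2 B3 B4 a1 b1 a2 b2 a3 b3 a4 b4 : unitary V ->
  esp P (fun t => (V *m conjby B1 t *m adj V) a1 b1 * (V *m conjby B2 t *m adj V) a2 b2 *
     (V *m conjby B3 t *m adj V) a3 b3 * (V *m conjby B4 t *m adj V) a4 b4) =
  esp P (fun t => conjby B1 t a1 b1 * conjby B2 t a2 b2 *
     conjby B3 t a3 b3 * conjby B4 t a4 b4).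
Proof.
move=> uV; pose f A := (A *m B1 *m adj A) a1 b1 * (A *m B2 *m adj A) a2 b2 *
     (A *m B3 *m adj A) a3 b3 * (A *m B4 *m adj A) a4 b4.
transitivity (esp P (fun t => f (V *m U t))).
  by apply: eq_esp => t; rewrite /f /conjby !adj_mul !mulmxA.
transitivity (esp P (fun t => f (U t))); last by [].
apply: esp_haar => //; rewrite /f.
by do 3![apply: ccontM; last exact: ccont_conjugate]; exact: ccont_conjugate.
Qed.

End HaarInvariance.

(** * Infinitesimal invariance *)

Section PolynomialCoefficient.
Variables (R : realType) (dsp : measure_display) (T : measurableType dsp).
Variable P : probability T R.
Local Notation C := R[i].

Lemma coef1M (K : nzRingType) (p q : {poly K}) :
  (p * q)`_1 = p`_0 * q`_1 + p`_1 * q`_0.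
Proof. by rewrite coefM !big_ord_recl big_ord0 addr0. Qed.

(** A nonzero difference would have as many distinct natural roots as its size, one more than its
    degree. *)
Lemma poly_eq_nat (K : numDomainType) (p q : {poly K}) :
  (forall n : nat, p.[n%:R] = q.[n%:R]) -> p = q.
Proof.
move=> h; apply/eqP; rewrite -subr_eq0; apply/negPn/negP => nz.
have := max_poly_roots (rs := [seq n%:R | n <- iota 0 (size (p - q))]) nz.
rewrite size_map size_iota ltnn map_inj_uniq ?iota_uniq => [|m n /eqP].
  suff -> : all (root (p - q)) [seq n%:R | n <- iota 0 (size (p - q))] by move=> /(_ isT isT).
  by apply/allP => _ /mapP [n _ ->]; rewrite /root hornerD hornerN h subrr.
by rewrite eqr_nat => /eqP.
Qed.

Definition bounded_rpoly (q : T -> {poly C}) := forall k, bounded_rv (fun t => (q t)`_k).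

Lemma bounded_rpolyM p q :
  bounded_rpoly p -> bounded_rpoly q -> bounded_rpoly (fun t => p t * q t).
Proof.
move=> bp bq k; under eq_fun do rewrite coefM.
by apply: bounded_rv_sum => i _; apply: bounded_rvM.
Qed.

Lemma bounded_rpoly_Poly (s : seq (T -> C)) :
  (forall k, bounded_rv (nth (fun=> 0) s k)) ->
  bounded_rpoly (fun t => Poly [seq f t | f <- s]).
Proof.
move=> bs k; suff -> : (fun t => (Poly [seq f t | f <- s])`_k) = nth (fun=> 0) s k by [].
apply/funext => t; rewrite coef_Poly; have [ks|sk] := ltnP k (size s).
  by rewrite (nth_map (fun=> 0)).
by rewrite !nth_default ?size_map.
Qed.

(** Taking expectations coefficientwise gives a polynomial that agrees with [r * c%:P] at all
    naturals, hence equals it. The derivative at 0 is then compared as a coefficient, without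
    differentiating under the integral. *)
Lemma esp_coef1_eq0 (q : T -> {poly C}) n (r : {poly C}) (c : C) :
  bounded_rpoly q -> (forall t, size (q t) <= n)%N -> r`_1 = 0 ->
  (forall k : nat, esp P (fun t => (q t).[k%:R]) = r.[k%:R] * c) ->
  esp P (fun t => (q t)`_1) = 0.
Proof.
(* The bound [n.+2] keeps degree 1 in range whatever [n] is. *)
move=> bq sq r1 h; pose p := \poly_(i < n.+2) esp P (fun t => (q t)`_i).
have -> : esp P (fun t => (q t)`_1) = p`_1 by rewrite coef_poly.
suff -> : p = r * c%:P by rewrite coefMC r1 mul0r.
apply: poly_eq_nat => k; rewrite hornerM hornerC -h horner_poly.
have e t : (q t).[k%:R] = \sum_(i < n.+2) k%:R ^+ i * (q t)`_i.
  rewrite (@horner_coef_wide _ n.+2); first by apply: eq_bigr => i _; rewrite mulrC.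
  by rewrite (leq_trans (sq t)) // -addn2 leq_addr.
under [in RHS]eq_fun do rewrite e; rewrite esp_sum => [|i _].
  by apply: eq_bigr => i _; rewrite espZ // mulrC.
by apply: bounded_rvM => //; exact: bounded_rv_cst.
Qed.

End PolynomialCoefficient.

Definition bracket (R : realType) d (X M : 'M[R[i]]_d) := X *m M - M *m X.

Lemma prod4_scale (K : comNzRingType) (w z1 z2 z3 z4 : K) :
  w ^+ 2 * z1 * (w ^+ 2 * z2) * (w ^+ 2 * z3) * (w ^+ 2 * z4) =
  w ^+ 8 * (z1 * z2 * z3 * z4).
Proof. by ring. Qed.

Lemma prod4_leibniz (K : comNzRingType) (y1 y2 y3 y4 z1 z2 z3 z4 : K) :
  y1 * y2 * y3 * (2 * z4) + (y1 * y2 * (2 * z3) + (y1 * (2 * z2) + 2 * z1 * y2) * y3) * y4 =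
  2 * (z1 * y2 * y3 * y4 + y1 * z2 * y3 * y4 + y1 * y2 * z3 * y4 + y1 * y2 * y3 * z4).
Proof. by ring. Qed.

(* For X anti-hermitian with X^3 = - X, exp(2 (arctan s) X) = (1 + s^2)^-1 *: cayley s, where
   Y = 1 + 2 X^2: after clearing denominators the unitary invariance becomes an identity between
   polynomials in s, whose coefficient of degree 1 is the infinitesimal invariance. *)
Section RationalRotation.
Variables (R : realType) (d : nat) (X Y : 'M[R[i]]_d).
Local Notation C := R[i].
Hypotheses (aX : adj X = - X) (aY : adj Y = Y) (XY : X *m Y = Y *m X).
Hypotheses (YY : Y *m Y = 1%:M) (XX : X *m X = 2^-1 *: (Y - 1%:M)).

Definition cayley (s : C) : 'M[C]_d := 1%:M + (2 * s) *: X + s ^+ 2 *: Y.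

Lemma adj_cayley s : s^* = s -> adj (cayley s) = 1%:M - (2 * s) *: X + s ^+ 2 *: Y.
Proof.
move=> sR; have aD (A B : 'M[C]_d) : adj (A + B) = adj A + adj B.
  by apply/matrixP=> i j; rewrite !(adjE, mxE) rmorphD.
rewrite /cayley !aD !adj_scale adj1 aX aY rmorphM rmorphXn /= sR.
by rewrite conjC_nat scalerN.
Qed.

Lemma cayley_unitary s : s^* = s -> unitary ((1 + s ^+ 2)^-1 *: cayley s).
Proof.
move=> sR; have nz : 1 + s ^+ 2 != 0.
  rewrite lt0r_neq0 // ltr_pwDl // -realEsqr.
  by apply/CrealP.
(* As X and Y commute, the product is (1 + s^2 Y)^2 - 4 s^2 X^2; with Y^2 = 1 and 4 X^2 = 2 (Y - 1)
   the terms in Y cancel. *)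
have e : cayley s *m adj (cayley s) = ((1 + s ^+ 2) ^+ 2)%:M.
  rewrite adj_cayley // /cayley.
  rewrite !(mulmxDl, mulmxDr, mulmxN, mulNmx, mul1mx, mulmx1).
  rewrite -!(scalemxAl, scalemxAr) XY XX YY !scalerA.
  by apply/matrixP=> i j; move: (Y *m X) => Z; rewrite !mxE; case: (i == j); field.
apply/eqP; rewrite adj_scale -scalemxAl -scalemxAr e scalerA scale_scalar_mx.
rewrite fmorphV rmorphD rmorph1 rmorphXn /= sR.
by congr (_%:M); field.
Qed.

Lemma cayley_conj s (M : 'M[C]_d) : s^* = s -> cayley s *m M *m adj (cayley s) =
  M + s *: (2 *: bracket X M) + s ^+ 2 *: (Y *m M + M *m Y - 4 *: (X *m M *m X)) +
  s ^+ 3 *: (2 *: (X *m M *m Y - Y *m M *m X)) + s ^+ 4 *: (Y *m M *m Y).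
Proof.
move=> sR; rewrite adj_cayley // /cayley /bracket.
rewrite !(mulmxDl, mulmxDr, mulmxN, mulNmx, mul1mx, mulmx1).
rewrite -!(scalemxAl, scalemxAr).
move: (X *m M) (M *m X) (Y *m M) (M *m Y) (Y *m M *m Y) (Y *m M *m X) (X *m M *m Y)
  (X *m M *m X) => Z1 Z2 Z3 Z4 Z5 Z6 Z7 Z8.
by apply/matrixP=> i j; rewrite !mxE; ring.
Qed.

End RationalRotation.

Lemma horner_Poly5 (R : realType) d (M0 M1 M2 M3 M4 : 'M[R[i]]_d) s a b :
  (Poly [:: M0 a b; M1 a b; M2 a b; M3 a b; M4 a b]).[s] =
  (M0 + s *: M1 + s ^+ 2 *: M2 + s ^+ 3 *: M3 + s ^+ 4 *: M4) a b.
Proof. by rewrite horner_Poly /= !mxE; ring. Qed.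

Section LieDerivative.
Variables (R : realType) (d : nat) (dsp : measure_display).
Variables (T : measurableType dsp) (P : probability T R) (U : T -> 'M[R[i]]_d).
Hypothesis haarU : haar_random P U.
Local Notation C := R[i].
Local Notation m B := (conjby U B).

Lemma esp_lie_antihermitian (X Y : 'M[C]_d) (B1 B2 B3 B4 : 'M[C]_d) a1 b1 a2 b2 a3 b3 a4 b4 :
  adj X = - X -> adj Y = Y -> X *m Y = Y *m X -> Y *m Y = 1%:M ->
  X *m X = 2^-1 *: (Y - 1%:M) ->
  esp P (fun t => bracket X (m B1 t) a1 b1 * m B2 t a2 b2 * m B3 t a3 b3 * m B4 t a4 b4 +
                  m B1 t a1 b1 * bracket X (m B2 t) a2 b2 * m B3 t a3 b3 * m B4 t a4 b4 +
                  m B1 t a1 b1 * m B2 t a2 b2 * bracket X (m B3 t) a3 b3 * m B4 t a4 b4 +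
                  m B1 t a1 b1 * m B2 t a2 b2 * m B3 t a3 b3 * bracket X (m B4 t) a4 b4) = 0.
Proof.
move=> aX aY XY YY XX.
pose c1 B t := 2 *: bracket X (m B t).
pose c2 B t := Y *m m B t + m B t *m Y - 4 *: (X *m m B t *m X).
pose c3 B t := 2 *: (X *m m B t *m Y - Y *m m B t *m X).
pose c4 B t := Y *m m B t *m Y.
(* The entry (a, b) of [cayley X Y s *m m B t *m adj (cayley X Y s)] as a polynomial in s. *)
pose q B a b t := Poly [seq f t | f <- [:: (fun t => m B t a b); (fun t => c1 B t a b);
  (fun t => c2 B t a b); (fun t => c3 B t a b); (fun t => c4 B t a b)]].
have bm B : bounded_rmx (m B) := bounded_conjby haarU B.
have bl (A A' B : 'M[C]_d) : bounded_rmx (fun t => A *m m B t *m A').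
  by apply: bounded_rmxM; [apply: bounded_rmxM => //|]; exact: bounded_rmx_cst.
have bX B : bounded_rmx (fun t => X *m m B t) by apply: bounded_rmxM => //; exact: bounded_rmx_cst.
have bX' B : bounded_rmx (fun t => m B t *m X) by apply: bounded_rmxM => //; exact: bounded_rmx_cst.
have bY B : bounded_rmx (fun t => Y *m m B t) by apply: bounded_rmxM => //; exact: bounded_rmx_cst.
have bY' B : bounded_rmx (fun t => m B t *m Y) by apply: bounded_rmxM => //; exact: bounded_rmx_cst.
have bc1 B : bounded_rmx (c1 B).
  by apply: bounded_rmxZ; apply: bounded_rmxD => //; exact: bounded_rmxN.
have bc2 B : bounded_rmx (c2 B).
  by apply: bounded_rmxD; [exact: bounded_rmxD | apply: bounded_rmxN; exact: bounded_rmxZ].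
have bc3 B : bounded_rmx (c3 B).
  by apply: bounded_rmxZ; apply: bounded_rmxD => //; exact: bounded_rmxN.
have bq B a b : bounded_rpoly (q B a b).
  apply: bounded_rpoly_Poly => -[|[|[|[|[|k]]]]] /=.
  - exact: bm.
  - exact: bc1.
  - exact: bc2.
  - exact: bc3.
  - exact: bl.
  - by rewrite nth_nil; exact: bounded_rv_cst.
have q0 B a b t : (q B a b t)`_0 = m B t a b by rewrite coef_Poly.
have q1 B a b t : (q B a b t)`_1 = 2 * bracket X (m B t) a b by rewrite coef_Poly /= mxE.
have sq B a b t : (size (q B a b t) <= 5)%N by exact: size_Poly.
have qE (s : C) B a b t : s^* = s ->
    (q B a b t).[s] = (cayley X Y s *m m B t *m adj (cayley X Y s)) a b.
  move=> sR; rewrite (cayley_conj aX aY) //.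
  exact: (horner_Poly5 (m B t) (c1 B t) (c2 B t) (c3 B t) (c4 B t) s a b).
pose Q t := q B1 a1 b1 t * q B2 a2 b2 t * q B3 a3 b3 t * q B4 a4 b4 t.
have bQ : bounded_rpoly Q by do 3![apply: bounded_rpolyM => //]; exact: bq.
have sQ t : (size (Q t) <= 5 + 5 + 5 + 5)%N.
  have sM (p r : {poly C}) k l : (size p <= k)%N -> (size r <= l)%N -> (size (p * r)%R <= k + l)%N.
    move=> pk rl; apply: leq_trans (size_polyMleq _ _) _.
    by apply: leq_trans (leq_pred _) _; exact: leq_add.
  by rewrite /Q; do 3!apply: (sM) => //.
(* Each of the four entries carries (1 + s^2)^2, one factor from the rotation and one from its
   adjoint. Only even powers of s occur, so there is no linear term. *)
pose r : {poly C} := (1 + 'X^2) ^+ 8.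
have r1 : r`_1 = 0.
  have p1 : (1 + 'X^2 : {poly C})`_1 = 0 by rewrite coefD coef1 coefXn addr0.
  have e (p : {poly C}) : (p ^+ 2)`_1 = 2 * (p`_0 * p`_1) by rewrite expr2 coef1M; ring.
  by rewrite /r -[8%N]/(2 * 2 * 2)%N 2!exprM 3!e p1 !mulr0.
pose c := esp P (fun t => m B1 t a1 b1 * m B2 t a2 b2 * m B3 t a3 b3 * m B4 t a4 b4).
have hQ (k : nat) : esp P (fun t => (Q t).[k%:R]) = r.[k%:R] * c.
  have kR : (k%:R : C)^* = k%:R by rewrite conjC_nat.
  have uV := cayley_unitary aX aY XY YY XX kR.
  set w := 1 + k%:R ^+ 2 in uV.
  have w0 : w != 0 by rewrite lt0r_neq0 // ltr_pwDl // exprn_ge0.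
  rewrite /c -(esp_conjby_inv haarU B1 B2 B3 B4 a1 b1 a2 b2 a3 b3 a4 b4 uV).
  set V := _ *: cayley X Y k%:R.
  have qV B a b t : (q B a b t).[k%:R] = w ^+ 2 * (V *m m B t *m adj V) a b.
    rewrite qE // /V adj_scale; move: (m B t) (cayley X Y _) => M N.
    rewrite -!scalemxAl -scalemxAr [X in _ * X]mxE [X in _ * (_ * X)]mxE.
    rewrite fmorphV rmorphD rmorph1 rmorphXn /= kR -/w mulrA.
    by move: (_ a b) => z; field.
  have -> : r.[k%:R] = w ^+ 8 by rewrite /r !hornerE.
  have bV B : bounded_rmx (fun t => V *m m B t *m adj V).
    by apply: bounded_rmxM; [apply: bounded_rmxM => //|]; exact: bounded_rmx_cst.
  rewrite -espZ; last first.
    by apply: bounded_rvM; [apply: bounded_rvM; [apply: bounded_rvM |] |]; exact: bV.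
  apply: eq_esp => t; rewrite /Q !hornerM !qV.
  exact: prod4_scale.
have := esp_coef1_eq0 bQ sQ r1 hQ.
rewrite (@eq_esp _ _ _ P _ (fun t => 2 * (
  bracket X (m B1 t) a1 b1 * m B2 t a2 b2 * m B3 t a3 b3 * m B4 t a4 b4 +
  m B1 t a1 b1 * bracket X (m B2 t) a2 b2 * m B3 t a3 b3 * m B4 t a4 b4 +
  m B1 t a1 b1 * m B2 t a2 b2 * bracket X (m B3 t) a3 b3 * m B4 t a4 b4 +
  m B1 t a1 b1 * m B2 t a2 b2 * m B3 t a3 b3 * bracket X (m B4 t) a4 b4))); last first.
  move=> t; rewrite /Q !(coef1M, coef0M) !q0 !q1.
  exact: prod4_leibniz.
have bb B a b : bounded_rv (fun t => bracket X (m B t) a b).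
  by apply: bounded_rmxD => //; exact: bounded_rmxN.
rewrite espZ => [/eqP|]; first by rewrite mulf_eq0 pnatr_eq0 /= => /eqP.
by repeat first [exact: bb | exact: bm | apply: bounded_rvD | apply: bounded_rvM].
Qed.

End LieDerivative.

(** * Derivations along elementary matrices *)

Section BracketRules.
Variables (K : comNzRingType) (d : nat).
Implicit Types M N : 'M[K]_d.

(** The derivative of a product of four entries under conjugation along X. It is linear in X over
    all of [K], which admits complex combinations of antihermitian directions. *)
Definition leibniz4 (X M1 M2 M3 M4 : 'M[K]_d) a1 b1 a2 b2 a3 b3 a4 b4 : K :=
  let br M := X *m M - M *m X in
  br M1 a1 b1 * M2 a2 b2 * M3 a3 b3 * M4 a4 b4 + M1 a1 b1 * br M2 a2 b2 * M3 a3 b3 * M4 a4 b4 +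
  M1 a1 b1 * M2 a2 b2 * br M3 a3 b3 * M4 a4 b4 + M1 a1 b1 * M2 a2 b2 * M3 a3 b3 * br M4 a4 b4.

Lemma leibniz4_lin c X1 X2 M1 M2 M3 M4 a1 b1 a2 b2 a3 b3 a4 b4 :
  leibniz4 (c *: X1 + X2) M1 M2 M3 M4 a1 b1 a2 b2 a3 b3 a4 b4 =
  c * leibniz4 X1 M1 M2 M3 M4 a1 b1 a2 b2 a3 b3 a4 b4 +
  leibniz4 X2 M1 M2 M3 M4 a1 b1 a2 b2 a3 b3 a4 b4.
Proof.
have e M a b : ((c *: X1 + X2) *m M - M *m (c *: X1 + X2)) a b =
    c * (X1 *m M - M *m X1) a b + (X2 *m M - M *m X2) a b.
  rewrite mulmxDl mulmxDr -scalemxAl -scalemxAr.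
  move: (X1 *m M) (M *m X1) (X2 *m M) (M *m X2) => Z1 Z2 Z3 Z4.
  by rewrite !mxE; ring.
rewrite /leibniz4 !e.
by move: (X1 *m M1 - _) (X1 *m M2 - _) (X1 *m M3 - _) (X1 *m M4 - _)
   (X2 *m M1 - _) (X2 *m M2 - _) (X2 *m M3 - _) (X2 *m M4 - _) => *; ring.
Qed.

Lemma bracket_delta (j i : 'I_d) M a b :
  (delta_mx j i *m M - M *m delta_mx j i) a b = (a == j)%:R * M i b - M a j * (b == i)%:R.
Proof.
rewrite !mxE (bigD1 i) //= big1 => [|k ki]; last by rewrite mxE (negbTE ki) andbF mul0r.
rewrite [X in _ - X](bigD1 j) //= big1 => [|k kj]; last by rewrite mxE (negbTE kj) mulr0.
by rewrite !mxE !eqxx andbT /= !addr0.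
Qed.

Lemma sum_row_col_neq M N (o p : 'I_d) :
  \sum_(j | j != o) M p j * N j p = (M *m N) p p - M p o * N o p.
Proof. by rewrite mxE [in RHS](bigD1 o) //= [RHS]addrC addKr. Qed.

(** Along E_jo the entry (o, o) of M_k becomes -(M_k)_oj, which pairs with (M4)_jo, and the entry
    (j, o) of M4 becomes (M4)_oo - (M4)_jj. Summing over j completes matrix products and a trace;
    the missing index j = o costs (M_k)_oo (M4)_oo for each of three factors, hence d + 3. *)
Lemma leibniz4_diag_sum M1 M2 M3 M4 (o : 'I_d) :
  \sum_(j | j != o) leibniz4 (delta_mx j o) M1 M2 M3 M4 o o o o o o j o =
  (d + 3)%:R * (M1 o o * M2 o o * M3 o o * M4 o o) - \tr M4 * (M1 o o * M2 o o * M3 o o)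
  - ((M1 *m M4) o o * M2 o o * M3 o o + (M2 *m M4) o o * M1 o o * M3 o o +
     (M3 *m M4) o o * M1 o o * M2 o o).
Proof.
transitivity (\sum_(j | j != o) (- (M2 o o * M3 o o) * (M1 o j * M4 j o)
   - (M1 o o * M3 o o) * (M2 o j * M4 j o) - (M1 o o * M2 o o) * (M3 o j * M4 j o)
   + M1 o o * M2 o o * M3 o o * (M4 o o - M4 j j))).
  apply: eq_bigr => j jo; rewrite /leibniz4 !bracket_delta eqxx (eq_sym o) (negbTE jo) eqxx /= ?mulr0n ?mulr1n.
  by ring.
rewrite !big_split /= !sumrN -!mulr_sumr !sum_row_col_neq.
have -> : \sum_(j | j != o) (M4 o o - M4 j j) = d%:R * M4 o o - \tr M4.
  have -> : d%:R * M4 o o - \tr M4 = \sum_j (M4 o o - M4 j j).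
    by rewrite sumrB sumr_const card_ord mulr_natl.
  by rewrite [in RHS](bigD1 o) //= subrr add0r.
move: (\tr M4) (M1 *m M4) (M2 *m M4) (M3 *m M4) => tr Z1 Z2 Z3.
by rewrite natrD; ring.
Qed.

(** For j outside {o, p} the direction E_jp does not move the entries at (o, o). The result contains
    the off-diagonal product (M3)_po (M4)_op, which is no diagonal moment; [sum_neq_complement]
    removes it by summing over p. *)
Lemma leibniz4_pair_sum M1 M2 M3 M4 (o p : 'I_d) : p != o -> \tr M4 = 0 ->
  \sum_(j | (j != o) && (j != p)) leibniz4 (delta_mx j p) M1 M2 M3 M4 o o o o p p j p =
  d%:R * (M1 o o * M2 o o * M3 p p * M4 p p) -
  M1 o o * M2 o o * ((M3 *m M4) p p - M3 p o * M4 o p - M3 p p * M4 o o).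
Proof.
move=> po tr0.
transitivity (\sum_(j | (j != o) && (j != p)) (- (M1 o o * M2 o o) * (M3 p j * M4 j p)
   + M1 o o * M2 o o * M3 p p * (M4 p p - M4 j j))).
  apply: eq_bigr => j /andP [jo jp].
  rewrite /leibniz4 !bracket_delta (eq_sym o) (negbTE jo) (eq_sym o) (negbTE po).
  by rewrite (eq_sym p) (negbTE jp) !eqxx /= ?mulr0n ?mulr1n; ring.
rewrite !big_split /= -!mulr_sumr.
have -> : \sum_(j | (j != o) && (j != p)) M3 p j * M4 j p =
    (M3 *m M4) p p - M3 p o * M4 o p - M3 p p * M4 p p.
  by rewrite -sum_row_col_neq [X in _ = X - _](bigD1 p) //= [RHS]addrC addKr.
have -> : \sum_(j | (j != o) && (j != p)) (M4 p p - M4 j j) =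
    d%:R * M4 p p - (M4 p p - M4 o o).
  have : \sum_j (M4 p p - M4 j j) = d%:R * M4 p p.
    by rewrite sumrB sumr_const card_ord mulr_natl -/(\tr M4) tr0 subr0.
  by rewrite (bigD1 o) //= (bigD1 p) //= subrr add0r => <-; rewrite [RHS]addrC addKr.
by move: (M3 *m M4) => Z; ring.
Qed.

(** Summed over p, the off-diagonal products form a diagonal entry of [M4 *m M3]. *)
Lemma sum_neq_complement M3 M4 (o : 'I_d) : \tr M3 = 0 ->
  \sum_(p | p != o) ((M3 *m M4) p p - M3 p o * M4 o p - M3 p p * M4 o o) =
  \tr (M3 *m M4) - (M3 *m M4) o o - (M4 *m M3) o o + 2 * (M3 o o * M4 o o).
Proof.
move=> tr0; rewrite !sumrB -mulr_suml.
have -> : \sum_(p | p != o) (M3 *m M4) p p = \tr (M3 *m M4) - (M3 *m M4) o o.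
  by rewrite /mxtrace [X in _ = X - _](bigD1 o) //= [RHS]addrC addKr.
have -> : \sum_(p | p != o) M3 p p = - M3 o o.
  by have := tr0; rewrite /mxtrace (bigD1 o) //= => h; apply: (addrI (M3 o o)); rewrite h subrr.
have -> : \sum_(p | p != o) M3 p o * M4 o p = (M4 *m M3) o o - M4 o o * M3 o o.
  by rewrite -sum_row_col_neq; apply: eq_bigr => p _; rewrite mulrC.
by move: (M3 *m M4) (M4 *m M3) => Z1 Z2; move: (\tr Z1) => z; ring.
Qed.

End BracketRules.

(** Two antihermitian directions combine, with a complex coefficient, to 2 E_ji. The right-hand side
    is written in the shape [c *: X1 + X2] of [leibniz4_lin]. *)
Lemma lie_directions_combine (K : numClosedFieldType) d (j i : 'I_d) :
  let X (z : K) := z *: delta_mx j i - z^* *: delta_mx i j : 'M[K]_d in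
  - 'i *: X 'i + X 1 = 1 *: delta_mx j i + delta_mx j i.
Proof.
move=> X; rewrite /X conjCi rmorph1; move: (delta_mx j i) (delta_mx i j) => A B.
have ii : 'i * 'i = -1 :> K by rewrite -expr2 sqrCi.
rewrite !scale1r scalerBr !scalerA mulNr mulrN !mulNr ii !opprK !(scaleN1r, scale1r).
by rewrite opprK addrACA subrr addr0.
Qed.

(** * Vanishing of the expected derivatives *)

Section MomentRecursion.
Variables (R : realType) (d : nat) (dsp : measure_display).
Variables (T : measurableType dsp) (P : probability T R) (U : T -> 'M[R[i]]_d).
Hypothesis haarU : haar_random P U.
Local Notation C := R[i].
Local Notation m B := (conjby U B).

Lemma bounded_leibniz4 X (M1 M2 M3 M4 : T -> 'M[C]_d) a1 b1 a2 b2 a3 b3 a4 b4 :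
  bounded_rmx M1 -> bounded_rmx M2 -> bounded_rmx M3 -> bounded_rmx M4 ->
  bounded_rv (fun t => leibniz4 X (M1 t) (M2 t) (M3 t) (M4 t) a1 b1 a2 b2 a3 b3 a4 b4).
Proof.
move=> m1 m2 m3 m4.
have br (M : T -> 'M[C]_d) : bounded_rmx M -> bounded_rmx (fun t => X *m M t - M t *m X).
  move=> bM; apply: bounded_rmxD; last apply: bounded_rmxN.
    by apply: bounded_rmxM => //; exact: bounded_rmx_cst.
  by apply: bounded_rmxM => //; exact: bounded_rmx_cst.
have p4 (f1 f2 f3 f4 : T -> C) : bounded_rv f1 -> bounded_rv f2 -> bounded_rv f3 ->
    bounded_rv f4 -> bounded_rv (fun t => f1 t * f2 t * f3 t * f4 t).
  by move=> *; do 3![apply: bounded_rvM => //].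
have e1 := br _ m1 a1 b1; have e2 := br _ m2 a2 b2.
have e3 := br _ m3 a3 b3; have e4 := br _ m4 a4 b4.
move: (m1 a1 b1) (m2 a2 b2) (m3 a3 b3) (m4 a4 b4) => g1 g2 g3 g4.
rewrite /leibniz4; apply: bounded_rvD; last exact: (p4 _ _ _ _ g1 g2 g3 e4).
apply: bounded_rvD; last exact: (p4 _ _ _ _ g1 g2 e3 g4).
apply: bounded_rvD; last exact: (p4 _ _ _ _ g1 e2 g3 g4).
exact: (p4 _ _ _ _ e1 g2 g3 g4).
Qed.

Let aD (A B : 'M[C]_d) : adj (A + B) = adj A + adj B.
Proof. by apply/matrixP=> k l; rewrite !(adjE, mxE) rmorphD. Qed.

(** For X^2 = - D with D a projection, the reflection 1 - 2 D = 1 + 2 X^2 serves as the matrix Y of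
    the rational rotation. *)
Lemma esp_lie_projection (X D B1 B2 B3 B4 : 'M[C]_d) a1 b1 a2 b2 a3 b3 a4 b4 :
  X *m D = X -> D *m X = X -> X *m X = - D -> D *m D = D -> adj X = - X -> adj D = D ->
  esp P (fun t => leibniz4 X (m B1 t) (m B2 t) (m B3 t) (m B4 t)
                    a1 b1 a2 b2 a3 b3 a4 b4) = 0.
Proof.
move=> XD DX XX DD aX aDD.
apply: (esp_lie_antihermitian haarU (Y := 1%:M - 2 *: D)) => //.
- by rewrite aD adj1 -scaleNr adj_scale aDD rmorphN /= conjC_nat.
- by rewrite mulmxBl mulmxBr mulmx1 mul1mx -scalemxAl -scalemxAr XD DX.
- rewrite mulmxBl !mulmxBr !mul1mx mulmx1 -!scalemxAl -!scalemxAr DD.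
  by apply/matrixP=> k l; rewrite !mxE; ring.
- rewrite XX; apply/matrixP=> k l; rewrite !mxE.
  by move: (D k l) => z'; field.
Qed.

Lemma esp_leibniz4_delta (j i : 'I_d) B1 B2 B3 B4 a1 b1 a2 b2 a3 b3 a4 b4 : i != j ->
  esp P (fun t => leibniz4 (delta_mx j i) (m B1 t) (m B2 t) (m B3 t) (m B4 t)
                    a1 b1 a2 b2 a3 b3 a4 b4) = 0.
Proof.
move=> ij; pose L X := esp P (fun t => leibniz4 X (m B1 t) (m B2 t) (m B3 t) (m B4 t)
                    a1 b1 a2 b2 a3 b3 a4 b4).
have bL X : bounded_rv (fun t => leibniz4 X (m B1 t) (m B2 t) (m B3 t) (m B4 t)
                    a1 b1 a2 b2 a3 b3 a4 b4).
  exact: (bounded_leibniz4 X a1 b1 a2 b2 a3 b3 a4 b4 (bounded_conjby haarU B1)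
    (bounded_conjby haarU B2) (bounded_conjby haarU B3) (bounded_conjby haarU B4)).
have Llin c X1 X2 : L (c *: X1 + X2) = c * L X1 + L X2.
  rewrite /L -espZ // -espD //; last exact: bounded_rvZ.
  by apply: eq_esp => t; exact: leibniz4_lin.
pose X (z : C) : 'M[C]_d := z *: delta_mx j i - z^* *: delta_mx i j.
(* The projection onto the coordinates i and j; X z squares to - D when z is a phase. *)
pose D : 'M[C]_d := delta_mx i i + delta_mx j j.
have ji : (j == i) = false by rewrite eq_sym (negbTE ij).
have adelta k l : adj (delta_mx k l : 'M[C]_d) = delta_mx l k.
  by apply/matrixP=> k' l'; rewrite adjE !mxE andbC rmorph_nat.
have mdelta k l k' l' : delta_mx k l *m delta_mx k' l' = (l == k')%:R *: delta_mx k l' :> 'M[C]_d.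
  by case: eqVneq => [->|lk]; rewrite ?mul_delta_mx ?mul_delta_mx_0 // ?scale1r ?scale0r.
have DD : D *m D = D.
  rewrite /D !(mulmxDl, mulmxDr) !mdelta !eqxx ji (negbTE ij) !scale1r !scale0r.
  by rewrite addr0 add0r.
have XD z : X z *m D = X z.
  rewrite /X /D !(mulmxDl, mulmxDr, mulNmx, mulmxN) -!scalemxAl !mdelta.
  by rewrite !eqxx ji (negbTE ij) !scale1r !scale0r !scaler0 ?oppr0 ?addr0 ?add0r.
have DX z : D *m X z = X z.
  rewrite /X /D !(mulmxDl, mulmxDr, mulNmx, mulmxN) -!scalemxAr !mdelta.
  by rewrite !eqxx ji (negbTE ij) !scale1r !scale0r !scaler0 ?oppr0 ?addr0 ?add0r addrC.
have XX z : z * z^* = 1 -> X z *m X z = - D.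
  move=> zz; rewrite /X !(mulmxDl, mulmxDr, mulNmx, mulmxN) -!scalemxAl -!scalemxAr !mdelta.
  rewrite !eqxx ji (negbTE ij) !scale1r !scale0r !scaler0 !scalerA (mulrC _ z) zz !scale1r.
  by rewrite /D opprD ?opprK ?oppr0 ?addr0 ?add0r addrC.
have L0 z : z * z^* = 1 -> L (X z) = 0.
  move=> zz; apply: (esp_lie_projection B1 B2 B3 B4 a1 b1 a2 b2 a3 b3 a4 b4 (XD z) (DX z) (XX z zz) DD).
  - by rewrite /X aD -scaleNr !adj_scale !adelta rmorphN /= conjCK !scaleNr opprB.
  - by rewrite /D aD !adelta.
have XE := lie_directions_combine C j i; rewrite -/X /= -!/(X _) in XE.
change (L (delta_mx j i) = 0).
clear - Llin L0 XE; clearbody L X.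
have h1 : L (X 1) = 0 by apply: L0; rewrite rmorph1 mulr1.
have hi : L (X 'i) = 0 by apply: L0; rewrite conjCi mulrN -expr2 sqrCi opprK.
(* One side is 2 L(E_ji); the other, by [XE], is a combination of L(X 'i) and L(X 1), both 0. *)
have /eqP := Llin 1 (delta_mx j i) (delta_mx j i).
by rewrite -XE Llin h1 hi mulr0 addr0 mul1r eq_sym -mulr2n mulrn_eq0 => /eqP.
Qed.

End MomentRecursion.

(** * Moments of the diagonal entries *)

Lemma recursion_rearrange (K : comNzRingType) (a b c x y z : K) :
  a - (b * c + (x + y + z)) = a + - b * c + (-1 * x + -1 * y + -1 * z).
Proof. by ring. Qed.

Section Moments.
Variables (R : realType) (d : nat) (dsp : measure_display).
Variables (T : measurableType dsp) (P : probability T R) (U : T -> 'M[R[i]]_d).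
Hypothesis haarU : haar_random P U.
Local Notation C := R[i].
Local Notation m B := (conjby U B).

Definition diag4 (M1 M2 M3 M4 : 'M[C]_d) i j k l : C :=
  M1 i i * M2 j j * M3 k k * M4 l l.

(* Lower-order moments are obtained by putting 1%:M in the remaining slots. *)
Definition mom (B1 B2 B3 B4 : 'M[C]_d) i j k l : C :=
  esp P (fun t => diag4 (m B1 t) (m B2 t) (m B3 t) (m B4 t) i j k l).

Lemma bounded_diag4 (M1 M2 M3 M4 : T -> 'M[C]_d) i j k l :
  bounded_rmx M1 -> bounded_rmx M2 -> bounded_rmx M3 -> bounded_rmx M4 ->
  bounded_rv (fun t => diag4 (M1 t) (M2 t) (M3 t) (M4 t) i j k l).
Proof.
move=> b1 b2 b3 b4; move: (b1 i i) (b2 j j) (b3 k k) (b4 l l) => c1 c2 c3 c4.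
by apply: bounded_rvM => //; apply: bounded_rvM => //; exact: bounded_rvM.
Qed.

Lemma bounded_mom B1 B2 B3 B4 i j k l :
  bounded_rv (fun t => diag4 (m B1 t) (m B2 t) (m B3 t) (m B4 t) i j k l).
Proof.
exact: (bounded_diag4 i j k l (bounded_conjby haarU B1) (bounded_conjby haarU B2)
  (bounded_conjby haarU B3) (bounded_conjby haarU B4)).
Qed.

(** Permutation matrices are unitary, and conjugation by one relabels the diagonal. *)
Lemma mom_perm (s : {perm 'I_d}) B1 B2 B3 B4 i j k l :
  mom B1 B2 B3 B4 (s i) (s j) (s k) (s l) = mom B1 B2 B3 B4 i j k l.
Proof.
have pE (M : 'M[C]_d) a : (perm_mx s *m M *m adj (perm_mx s)) a a = M (s a) (s a).
  have -> : adj (perm_mx s : 'M[C]_d) = perm_mx s^-1.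
    by rewrite -tr_perm_mx; apply/matrixP=> x y; rewrite adjE !mxE rmorph_nat.
  by rewrite -row_permE -col_permE !mxE.
have dE (M1 M2 M3 M4 : 'M[C]_d) : diag4 M1 M2 M3 M4 (s i) (s j) (s k) (s l) =
    (perm_mx s *m M1 *m adj (perm_mx s)) i i * (perm_mx s *m M2 *m adj (perm_mx s)) j j *
    (perm_mx s *m M3 *m adj (perm_mx s)) k k * (perm_mx s *m M4 *m adj (perm_mx s)) l l.
  by rewrite !pE.
transitivity (esp P (fun t =>
    (perm_mx s *m m B1 t *m adj (perm_mx s)) i i * (perm_mx s *m m B2 t *m adj (perm_mx s)) j j *
    (perm_mx s *m m B3 t *m adj (perm_mx s)) k k * (perm_mx s *m m B4 t *m adj (perm_mx s)) l l)).
  by apply: eq_esp => t; exact: dE.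
exact: (esp_conjby_inv haarU B1 B2 B3 B4 i i j j k k l l (unitary_perm R s)).
Qed.

Lemma mom_swap12 B1 B2 B3 B4 i j k l : mom B1 B2 B3 B4 i j k l = mom B2 B1 B3 B4 j i k l.
Proof.
apply: eq_esp => t; rewrite /diag4.
by rewrite (mulrC (m B1 t i i)).
Qed.

Lemma mom_swap23 B1 B2 B3 B4 i j k l : mom B1 B2 B3 B4 i j k l = mom B1 B3 B2 B4 i k j l.
Proof. by apply: eq_esp => t; rewrite /diag4 (mulrAC (m B1 t i i)). Qed.

Lemma mom_swap34 B1 B2 B3 B4 i j k l : mom B1 B2 B3 B4 i j k l = mom B1 B2 B4 B3 i j l k.
Proof. by apply: eq_esp => t; rewrite /diag4 (mulrAC (m B1 t i i * _)). Qed.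

Lemma momZ1 c B1 B2 B3 B4 i j k l :
  mom (c *: B1) B2 B3 B4 i j k l = c * mom B1 B2 B3 B4 i j k l.
Proof.
rewrite /mom -espZ; last exact: bounded_mom.
by apply: eq_esp => t; rewrite conjbyZ /diag4 mxE !mulrA.
Qed.

Lemma mom1 i j k l : mom 1%:M 1%:M 1%:M 1%:M i j k l = 1.
Proof.
rewrite -[RHS](esp_cst P); apply: eq_esp => t.
by rewrite /diag4 (conjby1 haarU) !mxE !eqxx !mulr1n !mul1r.
Qed.

Lemma leibniz4_diag4_sum (M1 M2 M3 M4 : 'M[C]_d) (o : 'I_d) :
  \sum_(j | j != o) leibniz4 (delta_mx j o) M1 M2 M3 M4 o o o o o o j o =
  (d + 3)%:R * diag4 M1 M2 M3 M4 o o o o + (- \tr M4) * diag4 M1 M2 M3 1%:M o o o o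
  + ((- 1) * diag4 (M1 *m M4) M2 M3 1%:M o o o o + (- 1) * diag4 (M2 *m M4) M1 M3 1%:M o o o o +
     (- 1) * diag4 (M3 *m M4) M1 M2 1%:M o o o o).
Proof.
rewrite leibniz4_diag_sum /diag4 [1%:M o o]mxE eqxx mulr1n !mulr1 !mulNr !mul1r -!opprD.
by [].
Qed.

(** The last factor is multiplied into another slot or replaced by its trace, leaving 1%:M behind,
    so the order of the moment drops by one. *)
Lemma mom_recursion B1 B2 B3 B4 o :
  (d + 3)%:R * mom B1 B2 B3 B4 o o o o = \tr B4 * mom B1 B2 B3 1%:M o o o o +
   (mom (B1 *m B4) B2 B3 1%:M o o o o + mom (B2 *m B4) B1 B3 1%:M o o o o +
    mom (B3 *m B4) B1 B2 1%:M o o o o).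
Proof.
have bL j : bounded_rv (fun t => leibniz4 (delta_mx j o) (m B1 t) (m B2 t) (m B3 t) (m B4 t)
                    o o o o o o j o).
  exact: (bounded_leibniz4 _ _ _ _ _ _ _ _ _ (bounded_conjby haarU B1)
    (bounded_conjby haarU B2) (bounded_conjby haarU B3) (bounded_conjby haarU B4)).
have : \sum_(j | j != o) esp P (fun t =>
    leibniz4 (delta_mx j o) (m B1 t) (m B2 t) (m B3 t) (m B4 t) o o o o o o j o) = 0.
  rewrite big1 // => j jo.
  by apply: (esp_leibniz4_delta haarU); rewrite eq_sym.
rewrite -esp_sum => [|j _]; last exact: bL.
pose F (Q1 Q2 Q3 Q4 : 'M[C]_d) t := diag4 (m Q1 t) (m Q2 t) (m Q3 t) (m Q4 t) o o o o.
rewrite (@eq_esp _ _ _ P _ (fun t => (d + 3)%:R * F B1 B2 B3 B4 t +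
  (- \tr B4) * F B1 B2 B3 1%:M t + ((- 1) * F (B1 *m B4) B2 B3 1%:M t +
  (- 1) * F (B2 *m B4) B1 B3 1%:M t + (- 1) * F (B3 *m B4) B1 B2 1%:M t))); last first.
  move=> t; rewrite /F (conjby1 haarU t) -(tr_conjby haarU B4 t).
  rewrite -(conjbyM haarU B1 B4 t) -(conjbyM haarU B2 B4 t) -(conjbyM haarU B3 B4 t).
  exact: leibniz4_diag4_sum.
have bF Q1 Q2 Q3 Q4 : bounded_rv (F Q1 Q2 Q3 Q4) := bounded_mom Q1 Q2 Q3 Q4 o o o o.
have bZ c Q1 Q2 Q3 Q4 : bounded_rv (fun t => c * F Q1 Q2 Q3 Q4 t) by exact: bounded_rvZ.
have FE Q1 Q2 Q3 Q4 : esp P (F Q1 Q2 Q3 Q4) = mom Q1 Q2 Q3 Q4 o o o o by [].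
clearbody F.
rewrite espD; [|exact: bounded_rvD|by apply: bounded_rvD; [exact: bounded_rvD|]].
rewrite espD // espD //; last exact: bounded_rvD.
rewrite espD // !espZ // !FE => h.
apply/eqP; rewrite -subr_eq0; apply/eqP; rewrite -[RHS]h.
exact: recursion_rearrange.
Qed.

End Moments.

Lemma pair_rearrange (K : comNzRingType) (D t x y1 y2 v : K) :
  D - (t * x - y1 - y2 + 2 * v) = D + (- t * x + y1 + (y2 + -2 * v)).
Proof. by ring. Qed.

(** * Moments at two distinct indices *)

Section PairMoments.
Variables (R : realType) (d : nat) (dsp : measure_display).
Variables (T : measurableType dsp) (P : probability T R) (U : T -> 'M[R[i]]_d).
Hypothesis haarU : haar_random P U.
Local Notation C := R[i].
Local Notation m B := (conjby U B).
Local Notation mom := (mom P U).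

Lemma leibniz4_diag4_pair_sum (M1 M2 M3 M4 : 'M[C]_d) (o : 'I_d) : \tr M3 = 0 -> \tr M4 = 0 ->
  \sum_(p | p != o) \sum_(j | (j != o) && (j != p))
      leibniz4 (delta_mx j p) M1 M2 M3 M4 o o o o p p j p =
  \sum_(p | p != o) d%:R * diag4 M1 M2 M3 M4 o o p p +
  ((- \tr (M3 *m M4)) * diag4 M1 M2 1%:M 1%:M o o o o + diag4 M1 M2 (M3 *m M4) 1%:M o o o o +
   (diag4 M1 M2 (M4 *m M3) 1%:M o o o o + (- 2) * diag4 M1 M2 M3 M4 o o o o)).
Proof.
move=> tr3 tr4.
under eq_bigr => p po do rewrite leibniz4_pair_sum //.
rewrite sumrB -[X in _ - X]mulr_sumr sum_neq_complement // /diag4 [1%:M o o]mxE eqxx mulr1n !mulr1.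
move: (\sum_(_ < d | _) _) (M3 *m M4) (M4 *m M3) => S Z1 Z2; move: (\tr Z1) => z.
by ring.
Qed.

Lemma mom_pair_sum B1 B2 B3 B4 o : \tr B3 = 0 -> \tr B4 = 0 ->
  d%:R * \sum_(p | p != o) mom B1 B2 B3 B4 o o p p =
  \tr (B3 *m B4) * mom B1 B2 1%:M 1%:M o o o o - mom B1 B2 (B3 *m B4) 1%:M o o o o
  - mom B1 B2 (B4 *m B3) 1%:M o o o o + 2 * mom B1 B2 B3 B4 o o o o.
Proof.
move=> tr3 tr4.
pose L p j t := leibniz4 (delta_mx j p) (m B1 t) (m B2 t) (m B3 t) (m B4 t) o o o o p p j p.
have bL p j : bounded_rv (L p j).
  exact: (bounded_leibniz4 _ _ _ _ _ _ _ _ _ (bounded_conjby haarU B1)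
    (bounded_conjby haarU B2) (bounded_conjby haarU B3) (bounded_conjby haarU B4)).
have : \sum_(p | p != o) \sum_(j | (j != o) && (j != p)) esp P (L p j) = 0.
  rewrite big1 // => p po; rewrite big1 // => j /andP [_ jp].
  by apply: (esp_leibniz4_delta haarU); rewrite eq_sym.
have -> : \sum_(p | p != o) \sum_(j | (j != o) && (j != p)) esp P (L p j) =
    esp P (fun t => \sum_(p | p != o) \sum_(j | (j != o) && (j != p)) L p j t).
  rewrite esp_sum => [|p _]; last by apply: bounded_rv_sum.
  by apply: eq_bigr => p _; rewrite esp_sum.
pose F (Q1 Q2 Q3 Q4 : 'M[C]_d) p t := diag4 (m Q1 t) (m Q2 t) (m Q3 t) (m Q4 t) o o p p.
rewrite (@eq_esp _ _ _ P _ (fun t => \sum_(p | p != o) d%:R * F B1 B2 B3 B4 p t +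
  ((- \tr (B3 *m B4)) * F B1 B2 1%:M 1%:M o t + F B1 B2 (B3 *m B4) 1%:M o t +
   (F B1 B2 (B4 *m B3) 1%:M o t + (- 2) * F B1 B2 B3 B4 o t)))); last first.
  move=> t; rewrite /F (conjby1 haarU t) -(tr_conjby haarU (B3 *m B4) t).
  rewrite -(conjbyM haarU B3 B4 t) -(conjbyM haarU B4 B3 t).
  by apply: leibniz4_diag4_pair_sum; rewrite (tr_conjby haarU).
have bF Q1 Q2 Q3 Q4 p : bounded_rv (F Q1 Q2 Q3 Q4 p) := bounded_mom haarU Q1 Q2 Q3 Q4 o o p p.
have bZ c Q1 Q2 Q3 Q4 p : bounded_rv (fun t => c * F Q1 Q2 Q3 Q4 p t) by exact: bounded_rvZ.
have FE Q1 Q2 Q3 Q4 p : esp P (F Q1 Q2 Q3 Q4 p) = mom Q1 Q2 Q3 Q4 o o p p by [].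
clearbody F.
rewrite espD; [|exact: bounded_rv_sum|by apply: bounded_rvD; exact: bounded_rvD].
rewrite espD; [|exact: bounded_rvD|exact: bounded_rvD].
rewrite espD // espD // !espZ // !FE esp_sum //.
have -> : \sum_(p | p != o) esp P (fun t => d%:R * F B1 B2 B3 B4 p t) =
    d%:R * \sum_(p | p != o) mom B1 B2 B3 B4 o o p p.
  by rewrite mulr_sumr; apply: eq_bigr => p _; rewrite espZ // FE.
move=> h; apply/eqP; rewrite -subr_eq0; apply/eqP; rewrite -[RHS]h.
exact: pair_rearrange.
Qed.

(** A transposition fixing o carries p to any q <> o, so the d - 1 terms of [mom_pair_sum] are
    equal. *)
Lemma mom_pair B1 B2 B3 B4 o p : \tr B3 = 0 -> \tr B4 = 0 -> p != o ->
  d%:R * (d%:R - 1) * mom B1 B2 B3 B4 o o p p =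
  \tr (B3 *m B4) * mom B1 B2 1%:M 1%:M o o o o - mom B1 B2 (B3 *m B4) 1%:M o o o o
  - mom B1 B2 (B4 *m B3) 1%:M o o o o + 2 * mom B1 B2 B3 B4 o o o o.
Proof.
move=> tr3 tr4 po; rewrite -mom_pair_sum // -mulrA; congr (_ * _).
rewrite (eq_bigr (fun=> mom B1 B2 B3 B4 o o p p)) => [|q qo].
  rewrite sumr_const cardC1 card_ord -[RHS]mulr_natl -subn1 natrB //.
  exact: leq_ltn_trans (leq0n _) (ltn_ord o).
have := mom_perm haarU (tperm p q) B1 B2 B3 B4 o o p p.
by rewrite tpermL tpermD.
Qed.

End PairMoments.

(** * Solving for the moments *)

Section MomentValues.
Variables (R : realType) (d : nat) (dsp : measure_display).
Variables (T : measurableType dsp) (P : probability T R) (U : T -> 'M[R[i]]_d).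
Hypothesis haarU : haar_random P U.
Local Notation C := R[i].
Local Notation mom := (mom P U).
Variables (B : 'M[C]_d) (o p : 'I_d).
Hypotheses (uB : unitary B) (trB : \tr B = 0) (po : p != o).
Local Notation B' := (adj B).

Let trB' : \tr B' = 0. Proof. by rewrite mxtrace_adj trB rmorph0. Qed.
Let BB' : B *m B' = 1%:M. Proof. exact: unitaryP. Qed.
Let B'B : B' *m B = 1%:M. Proof. exact: unitaryPV. Qed.

Let dge2 : (2 <= d)%N.
Proof.
have := ltn_ord o; have := ltn_ord p; move: po; rewrite -val_eqE /=.
by case: d (val o) (val p) => [|[|?]] [|?] [|?].
Qed.

Let nz k : (d%:R + k%:R : C) != 0.
Proof. by rewrite -natrD pnatr_eq0 -lt0n addn_gt0 (ltnW dge2). Qed.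

Let d_neq0 : (d%:R : C) != 0.
Proof. by rewrite pnatr_eq0 -lt0n (ltnW dge2). Qed.

Let d1_neq0 : (d%:R - 1 : C) != 0.
Proof. by rewrite subr_eq0 pnatr_eq1 gtn_eqF. Qed.

(** With 1%:M in two slots the recursion returns the unknown twice and B B' = 1 once: (d + 3) x = 1
    + 2 x. *)
Lemma mom_abs2 : mom B B' 1%:M 1%:M o o o o = (d%:R + 1)^-1.
Proof.
have := mom_recursion haarU 1%:M 1%:M B B' o.
rewrite trB' mul0r add0r !mul1mx BB' (mom1 haarU).
have -> : mom B' 1%:M B 1%:M o o o o = mom B B' 1%:M 1%:M o o o o.
  by rewrite [LHS]mom_swap23 [LHS]mom_swap12.
have -> : mom 1%:M 1%:M B B' o o o o = mom B B' 1%:M 1%:M o o o o.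
  by rewrite [LHS]mom_swap23 [LHS]mom_swap12 [LHS]mom_swap34 [LHS]mom_swap23.
move: (mom _ _ _ _ _ _ _ _) => x; rewrite natrD => h.
have n1 := nz 1; apply: (mulfI n1); rewrite divff //.
have -> : (d%:R + 1) * x = (d%:R + 3) * x - (x + x) by ring.
by rewrite h; ring.
Qed.

(** With w = W_oo these are E |w|^4 and E [w^2 conj((W^2)_oo)]. The square of B enters the system
    through [delta] and through the trace in [gammaE]. *)
Let alpha := mom B B' B B' o o o o.
Let delta := mom B B (B' *m B') 1%:M o o o o.

Let alphaE : (d%:R + 3) * alpha = 2 * (d%:R + 1)^-1 + delta.
Proof.
have := mom_recursion haarU B B' B B' o; rewrite trB' mul0r add0r BB' natrD => ->.
have -> : mom 1%:M B' B 1%:M o o o o = (d%:R + 1)^-1.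
  by rewrite -mom_abs2 [LHS]mom_swap12 [LHS]mom_swap23 [LHS]mom_swap12.
have -> : mom 1%:M B B' 1%:M o o o o = (d%:R + 1)^-1.
  by rewrite -mom_abs2 [LHS]mom_swap12 [LHS]mom_swap23.
have -> : mom (B' *m B') B B 1%:M o o o o = delta.
  by rewrite [LHS]mom_swap12 [LHS]mom_swap23.
by move: delta => x; ring.
Qed.

Let betaE : d%:R * (d%:R - 1) * mom B B' B B' o o p p =
  (d%:R - 2) * (d%:R + 1)^-1 + 2 * alpha.
Proof.
have := mom_pair haarU B B' trB trB' po; rewrite BB' B'B mom_abs2 mxtrace1 => ->.
by rewrite -/alpha; move: alpha => x; ring.
Qed.

Let beta'E : d%:R * (d%:R - 1) * mom B B' B B' o p p o =
  (d%:R - 2) * (d%:R + 1)^-1 + 2 * alpha.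
Proof.
have -> : mom B B' B B' o p p o = mom B B' B' B o o p p.
  by rewrite [LHS]mom_swap34 [LHS]mom_swap23.
have := mom_pair haarU B B' trB' trB po; rewrite BB' B'B mom_abs2 mxtrace1 => ->.
rewrite (mom_swap34 _ _ _ _ B' B) -/alpha; move: alpha => x; ring.
Qed.

Let gammaE : d%:R * (d%:R - 1) * mom B B' B B' o p o p =
  \tr (B' *m B') * mom B B 1%:M 1%:M o o o o - 2 * delta + 2 * alpha.
Proof.
have -> : mom B B' B B' o p o p = mom B B B' B' o o p p by rewrite [LHS]mom_swap23.
have := mom_pair haarU B B trB' trB' po => ->.
rewrite (mom_swap23 _ _ _ B B') -/alpha -/delta.
by move: (\tr _) alpha delta (mom _ _ _ _ _ _ _ _) => x y z w; ring.
Qed.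

Lemma moments_traceless_square : \tr (B *m B) = 0 ->
  [/\ mom B B' B B' o o o o = 2 / ((d%:R + 1) * (d%:R + 2)),
      mom B B' B B' o o p p = d%:R / ((d%:R - 1) * (d%:R + 1) * (d%:R + 2)),
      mom B B' B B' o p p o = d%:R / ((d%:R - 1) * (d%:R + 1) * (d%:R + 2)) &
      mom B B' B B' o p o p = 0].
Proof.
move=> tr2; have tr2' : \tr (B' *m B') = 0 by rewrite -adj_mul mxtrace_adj tr2 rmorph0.
have n1 := nz 1; have n2 := nz 2; have n3 := nz 3.
(* The recursion with B'^2 in the last slot: its trace vanishes, B B'^2 = B' produces two second
   moments, and [delta] recurs, so (d + 2) delta = 2 / (d + 1). *)
have dE : delta = 2 / ((d%:R + 1) * (d%:R + 2)).
  have := mom_recursion haarU 1%:M B B (B' *m B') o.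
  rewrite tr2' mul0r add0r mul1mx mulmxA BB' mul1mx natrD.
  have -> : mom 1%:M B B (B' *m B') o o o o = delta.
    by rewrite [LHS]mom_swap12 [LHS]mom_swap23 [LHS]mom_swap34.
  have -> : mom (B' *m B') B B 1%:M o o o o = delta.
    by rewrite [LHS]mom_swap12 [LHS]mom_swap23.
  have -> : mom B' 1%:M B 1%:M o o o o = (d%:R + 1)^-1.
    by rewrite -mom_abs2 [LHS]mom_swap23 [LHS]mom_swap12.
  move: delta => x h; apply: (mulfI n2).
  have -> : (d%:R + 2) * x = (d%:R + 3) * x - x by ring.
  by rewrite h; field; rewrite n1 n2.
have aE : alpha = 2 / ((d%:R + 1) * (d%:R + 2)).
  by apply: (mulfI n3); rewrite alphaE dE; field; rewrite n1 n2.
split=> //.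
- apply: (mulfI (mulf_neq0 d_neq0 d1_neq0)); rewrite betaE aE; field.
  by rewrite n1 n2 d1_neq0.
- apply: (mulfI (mulf_neq0 d_neq0 d1_neq0)); rewrite beta'E aE; field.
  by rewrite n1 n2 d1_neq0.
(* Here [alpha] and [delta] coincide, so the right-hand side of [gammaE] is 0. *)
- apply: (mulfI (mulf_neq0 d_neq0 d1_neq0)); rewrite gammaE dE aE tr2' mul0r mulr0.
  by ring.
Qed.

(** B is a phase times a hermitian involution, so B' is a multiple of B. The conjugate of w is then
    a multiple of w, and the three two-index patterns share one value. *)
Lemma moments_scalar_square (c : C) : B *m B = c%:M ->
  [/\ mom B B' B B' o o o o = 3 / ((d%:R + 1) * (d%:R + 3)),
      mom B B' B B' o o p p = ((d%:R - 1) * (d%:R + 3))^-1,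
      mom B B' B B' o p p o = ((d%:R - 1) * (d%:R + 3))^-1 &
      mom B B' B B' o p o p = ((d%:R - 1) * (d%:R + 3))^-1].
Proof.
move=> B2.
have n1 := nz 1; have n3 := nz 3.
have B2' : B' *m B' = (c^*)%:M.
  rewrite -adj_mul B2; apply/matrixP=> i j; rewrite adjE !mxE eq_sym.
  by case: (_ == _); rewrite ?mulr1n ?mulr0n ?rmorph0.
have B'E : B' = c^* *: B.
  by rewrite -[LHS]mulmx1 -B'B mulmxA B2' mul_scalar_mx.
have cB : c^* * mom B B 1%:M 1%:M o o o o = (d%:R + 1)^-1.
  by rewrite -mom_abs2 [in RHS]mom_swap12 [in RHS]B'E (momZ1 haarU).
have dE : delta = (d%:R + 1)^-1.
  rewrite /delta B2' -(scalemx1 _ c^*) [LHS]mom_swap23 [LHS]mom_swap12 (momZ1 haarU) -cB.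
  by rewrite [in LHS]mom_swap12 [in LHS]mom_swap23.
have aE : alpha = 3 / ((d%:R + 1) * (d%:R + 3)).
  by apply: (mulfI n3); rewrite alphaE dE; field; rewrite n1 n3.
split=> //.
- apply: (mulfI (mulf_neq0 d_neq0 d1_neq0)); rewrite betaE aE; field.
  by rewrite n1 n3 d1_neq0.
- apply: (mulfI (mulf_neq0 d_neq0 d1_neq0)); rewrite beta'E aE; field.
  by rewrite n1 n3 d1_neq0.
- apply: (mulfI (mulf_neq0 d_neq0 d1_neq0)); rewrite gammaE dE aE B2' mxtrace_scalar.
  have -> : c^* *+ d * mom B B 1%:M 1%:M o o o o = d%:R * (d%:R + 1)^-1.
    by rewrite -cB -[c^* *+ d]mulr_natl mulrA.
  by field; rewrite n1 n3 d1_neq0.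
Qed.

End MomentValues.

(** * Exchangeable tensors with vanishing marginals *)

Section ExchangeableTensor.
Variables (K : numFieldType) (d : nat).
Implicit Types T : 'I_d -> 'I_d -> 'I_d -> 'I_d -> K.

(** Slots 1 and 3 hold w, slots 2 and 4 its conjugate, so iijj and ijji share the value b while ijij
    has its own value g. The zero sums are stated for slots 4 and 3 to make the notion stable under
    [exchangeable_swap]. *)
Definition exchangeable T (a b g : K) : Prop :=
  [/\ forall (s : {perm 'I_d}) i j k l, T (s i) (s j) (s k) (s l) = T i j k l,
      forall i j k l, T i j k l = T k j i l /\ T i j k l = T i l k j,
      forall i j k, \sum_l T i j k l = 0 /\ \sum_l T j i l k = 0 &
      forall i, T i i i i = a /\ forall j, j != i -> T i i j j = b /\ T i j i j = g].

Lemma sum_const_off (r : seq 'I_d) (f : 'I_d -> K) c : uniq r ->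
  (forall l, l \notin r -> f l = c) -> \sum_l f l = \sum_(l <- r) (f l - c) + d%:R * c.
Proof.
move=> ur fc; have -> : d%:R * c = \sum_(l < d) c by rewrite sumr_const card_ord mulr_natl.
apply/eqP; rewrite -subr_eq -sumrB; apply/eqP.
by rewrite (big_uniq _ ur) /= [LHS](bigID (mem r)) /= [X in _ + X]big1 ?addr0 // => l /fc ->; rewrite subrr.
Qed.

(* The values of T when three indices are equal (val3), when exactly one pair is equal (val2; x is
   the value at the two-pair pattern containing that pair), and at distinct indices (val1). At d = 2 and d = 3 the
   zero denominators occur only for patterns that cannot be realised in 'I_d. *)
Definition val3 (a : K) : K := - a / (d%:R - 1).
Definition val2 (a x : K) : K := - (val3 a + x) / (d%:R - 2).
Definition val1 (a b g : K) : K := - (2 * val2 a b + val2 a g) / (d%:R - 3).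

(** A list of n + 1 distinct indices forces d > n; this clears the denominators d - 1, d - 2, d - 3
    without a hypothesis on d. *)
Lemma card_uniq_ord (r : seq 'I_d) n : uniq r -> size r = n.+1 -> (d%:R - n%:R : K) != 0.
Proof.
move=> /card_uniqP cr sr; rewrite subr_eq0 eqr_nat gtn_eqF //.
by rewrite -sr -cr -[X in (_ <= X)%N]card_ord max_card.
Qed.

Lemma tperm_fix (x y z : 'I_d) : x != y -> x != z -> tperm y z x = x.
Proof. by move=> xy xz; rewrite tpermD // eq_sym. Qed.

Lemma exchangeable_swap T a b g : exchangeable T a b g ->
  exchangeable (fun i j k l => T j i l k) a b g.
Proof.
move=> [inv sym s0 v]; split=> [s i j k l|i j k l|i j k|i].
- exact: inv.
- by case: (sym j i l k).
- by case: (s0 i j k) => h1 h2; split.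
- case: (v i) => va vb; split=> // j ji; split; first by case: (vb j ji).
  by case: (v j) => _ /(_ i); rewrite eq_sym => /(_ ji) [].
Qed.

Lemma exchangeable3 T a b g i l : exchangeable T a b g -> i != l -> T i i i l = val3 a.
Proof.
move=> [inv sym s0 v] il; have [h _] := s0 i i i.
have nz := @card_uniq_ord [:: i; l] 1 _ _.
have {nz} /nz : uniq [:: i; l] by rewrite /= inE il.
move=> /(_ erefl) nz; move: h; rewrite (@sum_const_off [:: i] _ (T i i i l)) // => [|l'].
  rewrite big_seq1; case: (v i) => -> _ h; apply: (mulfI nz); rewrite /val3 [RHS]mulrC divfK //.
  by apply/eqP; rewrite -addr_eq0; apply/eqP; rewrite -[RHS]h; ring.
rewrite inE => l'i; rewrite -(inv (tperm l l') i i i l) tpermL tperm_fix //.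
by rewrite eq_sym.
Qed.

(** In the zero sum over the last slot, the values i and k give [val3] and a two-pair value; the d -
    2 other terms are equal. *)
Lemma exchangeable2 T a b g i k l : exchangeable T a b g -> uniq [:: i; k; l] ->
  T i i k l = val2 a b /\ T i k i l = val2 a g.
Proof.
move=> ex u; have := u; rewrite /= !inE negb_or andbT => /andP [/andP [ik il] kl].
have nz := card_uniq_ord u (erefl : size [:: i; k; l] = 3%N).
have ex' := exchangeable_swap ex; have [inv sym s0 v] := ex.
have eik l' : l' \notin [:: i; k] -> tperm l l' i = i /\ tperm l l' k = k.
  by rewrite !inE negb_or => /andP [l'i l'k]; rewrite !tperm_fix // eq_sym.
have uik : uniq [:: i; k] by rewrite /= inE ik.
split.
- have [] := s0 i i k; rewrite (@sum_const_off [:: i; k] _ (T i i k l)) // => [|l' l'n].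
    rewrite big_cons big_seq1; have -> : T i i k i = val3 a by exact: (exchangeable3 ex').
    case: (v i) => _ /(_ k); rewrite eq_sym => /(_ ik) [-> _] h _.
    apply: (mulfI nz); rewrite /val2 [RHS]mulrC divfK //.
    by apply/eqP; rewrite -addr_eq0; apply/eqP; rewrite -[RHS]h; ring.
  by rewrite -(inv (tperm l l') i i k l) tpermL; case: (eik l' l'n) => -> ->.
- have [] := s0 i k i; rewrite (@sum_const_off [:: i; k] _ (T i k i l)) // => [|l' l'n].
    rewrite big_cons big_seq1; have -> : T i k i i = val3 a.
      by case: (sym i k i i) => _ ->; exact: (exchangeable3 ex).
    case: (v i) => _ /(_ k); rewrite eq_sym => /(_ ik) [_ ->] h _.
    apply: (mulfI nz); rewrite /val2 [RHS]mulrC divfK //.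
    by apply/eqP; rewrite -addr_eq0; apply/eqP; rewrite -[RHS]h; ring.
  by rewrite -(inv (tperm l l') i k i l) tpermL; case: (eik l' l'n) => -> ->.
Qed.

(** Letting the last index equal i, j or k pairs slots {1,4}, {2,4} or {3,4}. The pair {2,4} joins
    two conjugate slots and uses g; the others use b. *)
Lemma exchangeable1 T a b g i j k l : exchangeable T a b g -> uniq [:: i; j; k; l] ->
  T i j k l = val1 a b g.
Proof.
move=> ex u; have := u; rewrite /= !inE !negb_or andbT.
move=> /andP [/and3P [ij ik il] /andP [/andP [jk jl] kl]].
have nz := card_uniq_ord u (erefl : size [:: i; j; k; l] = 4%N).
have ex' := exchangeable_swap ex; have [inv sym s0 v] := ex.
have uijk : uniq [:: i; j; k] by rewrite /= !inE negb_or ij ik jk.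
have [] := s0 i j k; rewrite (@sum_const_off [:: i; j; k] _ (T i j k l)) // => [|l'].
  rewrite !big_cons big_nil.
  have -> : T i j k i = val2 a b.
    have uq : uniq [:: i; k; j] by rewrite /= !inE negb_or ik ij eq_sym jk.
    by case: (sym i j k i) => _ ->; case: (exchangeable2 ex uq).
  have -> : T i j k k = val2 a b.
    have uq : uniq [:: k; i; j] by rewrite /= !inE negb_or (eq_sym k) ik eq_sym jk ij.
    by case: (sym i j k k) => -> _; case: (sym k j i k) => _ ->; case: (exchangeable2 ex uq).
  have -> : T i j k j = val2 a g.
    have uq : uniq [:: j; i; k] by rewrite /= !inE negb_or eq_sym ij jk ik.
    by case: (exchangeable2 ex' uq).
  move=> h _; apply: (mulfI nz); rewrite /val1 [RHS]mulrC divfK //.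
  by apply/eqP; rewrite -addr_eq0; apply/eqP; rewrite -[RHS]h; ring.
rewrite !inE !negb_or => /and3P [l'i l'j l'k].
by rewrite -(inv (tperm l l') i j k l) tpermL !tperm_fix // eq_sym.
Qed.

(* The coefficients come from Moebius inversion over the lattice of the 15 set partitions
   of the four index slots. *)
Lemma exchangeableE T a b g i j k l : exchangeable T a b g ->
  let u := val2 a b in let u' := val2 a g in let z := val1 a b g in
  let t3 := val3 a + 2 * z - 2 * u - u' in
  let t1 := a - 4 * val3 a - (2 * b + g) + 8 * u + 4 * u' - 6 * z in
  let e (x y : 'I_d) : K := (x == y)%:R in
  T i j k l = z + (u - z) * (e i j + e i l + e j k + e k l) + (u' - z) * (e i k + e j l)
   + t3 * (e i j * e j k + e i j * e j l + e i k * e k l + e j k * e k l)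
   + (b - 2 * u + z) * (e i j * e k l + e i l * e j k) + (g - 2 * u' + z) * (e i k * e j l)
   + t1 * (e i j * e j k * e k l).
Proof.
move=> ex; have ex' := exchangeable_swap ex; have [inv sym s0 v] := ex.
move=> u u' z t3 t1 e.
have T1 x y : x != y -> T x x x y = val3 a by exact: (exchangeable3 ex).
have T2 x y : x != y -> T x x y x = val3 a by exact: (exchangeable3 ex').
have Tb x y : x != y -> T x x y y = b.
  by move=> xy; case: (v x) => _ /(_ y); rewrite eq_sym => /(_ xy) [].
have Tg x y : x != y -> T x y x y = g.
  by move=> xy; case: (v x) => _ /(_ y); rewrite eq_sym => /(_ xy) [].
have Ta x : T x x x x = a by case: (v x).
have uq (x y w : 'I_d) : x != y -> x != w -> y != w -> uniq [:: x; y; w].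
  by move=> xy xw yw; rewrite /= !inE negb_or xy xw yw.
have Tu x y w : x != y -> x != w -> y != w -> T x x y w = u.
  by move=> xy xw yw; case: (exchangeable2 ex (uq x y w xy xw yw)).
have Tu' x y w : x != y -> x != w -> y != w -> T x y x w = u'.
  by move=> xy xw yw; case: (exchangeable2 ex (uq x y w xy xw yw)).
have Tu'' x y w : x != y -> x != w -> y != w -> T y x w x = u'.
  by move=> xy xw yw; case: (exchangeable2 ex' (uq x y w xy xw yw)).
have s1 x y w r : T x y w r = T w y x r by case: (sym x y w r).
have s2 x y w r : T x y w r = T x r w y by case: (sym x y w r).
rewrite /e; case: (eqVneq i j) => [<-|ij].
  case: (eqVneq i k) => [<-|ik].
    case: (eqVneq i l) => [<-|il]. rewrite Ta ?eqxx /= ?mulr1n ?mulr0n /t1 /t3; ring.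
    by rewrite T1 // ?eqxx /= ?mulr1n ?mulr0n /t3; ring.
  case: (eqVneq i l) => [<-|il].
    by rewrite T2 // (eq_sym k i) (negbTE ik) ?eqxx /= ?mulr1n ?mulr0n /t3; ring.
  case: (eqVneq k l) => [<-|kl]; first by rewrite Tb // ?eqxx /= ?mulr1n ?mulr0n; ring.
  by rewrite Tu // ?eqxx /= ?mulr1n ?mulr0n; ring.
case: (eqVneq i k) => [<-|ik].
  rewrite (eq_sym j i) (negbTE ij); case: (eqVneq i l) => [<-|il].
    by rewrite s2 T1 // (eq_sym j i) (negbTE ij) ?eqxx /= ?mulr1n ?mulr0n /t3; ring.
  case: (eqVneq j l) => [<-|jl]; first by rewrite Tg // ?eqxx /= ?mulr1n ?mulr0n; ring.
  by rewrite Tu' // ?eqxx /= ?mulr1n ?mulr0n; ring.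
case: (eqVneq i l) => [<-|il].
  rewrite (eq_sym j i) (negbTE ij) (eq_sym k i) (negbTE ik).
  case: (eqVneq j k) => [<-|jk]; first by rewrite s2 Tb // ?eqxx /= ?mulr1n ?mulr0n; ring.
  by rewrite s2 Tu // 1?eq_sym // ?eqxx /= ?mulr1n ?mulr0n; ring.
case: (eqVneq j k) => [<-|jk].
  case: (eqVneq j l) => [<-|jl].
    by rewrite s1 T2 1?eq_sym // ?eqxx /= ?mulr1n ?mulr0n /t3; ring.
  by rewrite s1 Tu // 1?eq_sym // ?eqxx /= ?mulr1n ?mulr0n; ring.
case: (eqVneq j l) => [<-|jl].
  by rewrite (eq_sym k j) (negbTE jk) Tu'' // 1?eq_sym // ?eqxx /= ?mulr1n ?mulr0n; ring.
case: (eqVneq k l) => [<-|kl].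
  by rewrite s1 s2 Tu // 1?eq_sym // ?eqxx /= ?mulr1n ?mulr0n; ring.
rewrite (exchangeable1 ex); first by rewrite /= ?mulr0n -/z; ring.
by rewrite /= !inE !negb_or ij ik il jk jl kl.
Qed.

End ExchangeableTensor.

(** * Contraction with the eigenvalues *)

Section Contraction.
Variables (K : numFieldType) (d : nat) (T : 'I_d -> 'I_d -> 'I_d -> 'I_d -> K) (a b g : K).
Variables (l l' : 'I_d -> K).
Hypotheses (exT : exchangeable T a b g) (ll' : forall i, l' i * l i = 1).
Hypotheses (l0 : \sum_i l i = 0) (l'0 : \sum_i l' i = 0).

Local Notation e i j := ((i == j)%:R : K).

Lemma sum_delta (f : 'I_d -> K) i : \sum_x f x * e i x = f i.
Proof.
rewrite (bigD1 i) //= eqxx mulr1 big1 ?addr0 // => x xi.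
by rewrite eq_sym (negbTE xi) mulr0.
Qed.

(** The surviving set partitions, each with its Moebius coefficient: one block gives d; {12}{34} and
    {14}{23} give d^2 each; {13}{24} gives s, the product of the power sums of order 2 of [l] and
    [l']. *)
Definition contracted (s : K) : K :=
  (a - 4 * val3 d a - (2 * b + g) + 8 * val2 d a b + 4 * val2 d a g - 6 * val1 d a b g) * d%:R
  + 2 * (b - 2 * val2 d a b + val1 d a b g) * d%:R ^+ 2
  + (g - 2 * val2 d a g + val1 d a b g) * s.

Lemma contraction :
  \sum_i \sum_j \sum_k \sum_r l' i * l j * l' k * l r * T i j k r =
  contracted ((\sum_i l i ^+ 2) * (\sum_i l' i ^+ 2)).
Proof.
rewrite /contracted.
set u := val2 d a b; set u' := val2 d a g; set z := val1 d a b g; set v := val3 d a.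
pose t3 := v + 2 * z - 2 * u - u'.
set t1 := a - _ - _ + _ + _ - _; set p := b - _ + _; set q := g - _ + _.
have sum_ll' : \sum_i l' i * l i = d%:R.
  by rewrite (eq_bigr (fun=> 1)) => [|k _]; rewrite ?sumr_const ?card_ord.
(* The slots are summed out one at a time from the last. Terms free of a delta on the summed index
   vanish by [l0] or are evaluated by [ll']; a delta evaluates the rest. *)
have step4 i j k : \sum_r l r * T i j k r =
    (u - z) * (l i + l k) + (u' - z) * l j
    + t3 * (e i j * l j + e i k * l k + e j k * l k)
    + p * (e i j * l k + e j k * l i) + q * (e i k * l j) + t1 * (e i j * e j k * l k).
  transitivity (\sum_r ((z + (u - z) * (e i j + e j k) + (u' - z) * e i k + t3 * (e i j * e j k)) * l r
    + (u - z + p * e j k) * (l r * e i r) + (u' - z + t3 * e i j + q * e i k) * (l r * e j r)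
    + (u - z + t3 * (e i k + e j k) + p * e i j + t1 * (e i j * e j k)) * (l r * e k r))).
    by apply: eq_bigr => r _; rewrite (exchangeableE i j k r exT) /= /t1 /p /q /t3 /u /u' /z /v; ring.
  rewrite !big_split /= -!mulr_sumr l0 !sum_delta; ring.
have step3 i j : \sum_k l' k * ((u - z) * (l i + l k) + (u' - z) * l j
    + t3 * (e i j * l j + e i k * l k + e j k * l k)
    + p * (e i j * l k + e j k * l i) + q * (e i k * l j) + t1 * (e i j * e j k * l k)) =
    (u - z) * d%:R + t3 * 2 + p * (e i j * d%:R + l' j * l i) + q * (l' i * l j) + t1 * e i j.
  transitivity (\sum_k (((u - z) * l i + (u' - z) * l j + t3 * (e i j * l j)) * l' k
    + (u - z + p * e i j) * (l' k * l k) + t3 * (l' k * l k * e i k)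
    + (t3 + t1 * e i j) * (l' k * l k * e j k) + p * l i * (l' k * e j k)
    + q * l j * (l' k * e i k))).
    by apply: eq_bigr => k _; ring.
  rewrite !big_split /= -!mulr_sumr l'0 !sum_delta !ll'.
  by rewrite sum_ll'; ring.
have step2 i : \sum_j l j * ((u - z) * d%:R + t3 * 2 + p * (e i j * d%:R + l' j * l i)
     + q * (l' i * l j) + t1 * e i j) =
    p * (2 * d%:R * l i) + q * (l' i * \sum_j l j ^+ 2) + t1 * l i.
  transitivity (\sum_j (((u - z) * d%:R + t3 * 2) * l j + (p * d%:R + t1) * (l j * e i j)
    + p * l i * (l' j * l j) + q * l' i * l j ^+ 2)).
    by apply: eq_bigr => j _; ring.
  rewrite !big_split /= -!mulr_sumr l0 !sum_delta.
  by rewrite sum_ll'; ring.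
transitivity (\sum_i l' i * (p * (2 * d%:R * l i) + q * (l' i * \sum_j l j ^+ 2) + t1 * l i)).
  apply: eq_bigr => i _; rewrite -step2 mulr_sumr; apply: eq_bigr => j _.
  rewrite -step3 2!mulr_sumr; apply: eq_bigr => k _; rewrite -step4 3!mulr_sumr.
  by apply: eq_bigr => r _; rewrite !mulrA.
transitivity (\sum_i ((p * 2 * d%:R + t1) * (l' i * l i) + q * (\sum_j l j ^+ 2) * l' i ^+ 2)).
  by apply: eq_bigr => i _; move: (\sum_j _) => S; ring.
rewrite !big_split /= -!mulr_sumr.
by rewrite sum_ll'; move: (\sum_j _) (\sum_i _) => S S'; ring.
Qed.

End Contraction.

(** * Closed forms of the contraction *)

Section RationalValues.
Variables (K : numFieldType) (d : nat).
Local Notation D := (d%:R : K).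

Let natn0 k : (0 < d)%N -> (D + k%:R) != 0.
Proof. by move=> d0; rewrite -natrD pnatr_eq0 -lt0n addn_gt0 d0. Qed.

Let natm0 k : (d != k)%N -> (D - k%:R) != 0.
Proof. by rewrite subr_eq0 eqr_nat. Qed.

(** The first letter is the type of the operator supplying the moments, the second that of the
    contracted one: h for a scalar square, where s = d^2, and g for a traceless square, where s =
    0. *)
Lemma contracted_hh : (2 <= d)%N -> (d != 3)%N ->
  contracted d (3 / ((D + 1) * (D + 3))) ((D - 1) * (D + 3))^-1 ((D - 1) * (D + 3))^-1 (D ^+ 2) =
  3 * D ^+ 2 * (D ^+ 2 - 8) / ((D ^+ 2 - 9) * (D ^+ 2 - 1)).
Proof.
move=> d2 d3; have d0 := ltnW d2.
have n1 := natn0 1 d0; have n3 := natn0 3 d0; have m3 := natm0 d3.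
have m1 : D - 1 != 0 by apply: (natm0 (k := 1%N)); rewrite gtn_eqF.
have x9 : D ^+ 2 - 9 != 0.
  have -> : D ^+ 2 - 9 = (D - 3) * (D + 3) by ring.
  exact: mulf_neq0.
have x1 : D ^+ 2 - 1 != 0.
  have -> : D ^+ 2 - 1 = (D - 1) * (D + 1) by ring.
  exact: mulf_neq0.
(* At d = 2 the division by zero makes [val2], and with it [val1], equal to 0; the formula still
   holds. *)
rewrite /contracted /val1 /val2 /val3; case: (eqVneq d 2%N) => [E|dn2].
  by rewrite E subrr invr0 !mulr0; field.
have m2 := natm0 dn2.
by field; rewrite n1 n3 m1 m2 m3 x9 x1.
Qed.

Lemma contracted_gg : (3 <= d)%N ->
  contracted d (2 / ((D + 1) * (D + 2))) (D / ((D - 1) * (D + 1) * (D + 2))) 0 0 =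
  2 * D ^+ 2 * (D ^+ 2 - 3) / ((D ^+ 2 - 4) * (D ^+ 2 - 1)).
Proof.
move=> d3; have d0 := ltnW (ltnW d3).
have n1 := natn0 1 d0; have n2 := natn0 2 d0.
have m1 : D - 1 != 0 by apply: (natm0 (k := 1%N)); rewrite gtn_eqF // ltnW.
have m2 : D - 2 != 0 by apply: natm0; rewrite gtn_eqF.
have x4 : D ^+ 2 - 4 != 0.
  have -> : D ^+ 2 - 4 = (D - 2) * (D + 2) by ring.
  exact: mulf_neq0.
have x1 : D ^+ 2 - 1 != 0.
  have -> : D ^+ 2 - 1 = (D - 1) * (D + 1) by ring.
  exact: mulf_neq0.
(* At d = 3 only [val1] degenerates to 0. *)
rewrite /contracted /val1 /val2 /val3; case: (eqVneq d 3%N) => [E|dn3].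
  by rewrite E subrr invr0 !mulr0; field.
have m3 := natm0 dn3.
by field; rewrite n1 n2 m1 m2 m3 x4 x1.
Qed.

Lemma contracted_gh : (4 <= d)%N ->
  contracted d (2 / ((D + 1) * (D + 2))) (D / ((D - 1) * (D + 1) * (D + 2))) 0 (D ^+ 2) =
  2 * D ^+ 2 / (D ^+ 2 - 1).
Proof.
move=> d4; have d0 := ltnW (ltnW (ltnW d4)).
have n1 := natn0 1 d0; have n2 := natn0 2 d0.
have m1 : D - 1 != 0 by apply: (natm0 (k := 1%N)); rewrite gtn_eqF // ltnW // ltnW.
have m2 : D - 2 != 0 by apply: natm0; rewrite gtn_eqF // ltnW.
have m3 : D - 3 != 0 by apply: natm0; rewrite gtn_eqF.
have x1 : D ^+ 2 - 1 != 0.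
  have -> : D ^+ 2 - 1 = (D - 1) * (D + 1) by ring.
  exact: mulf_neq0.
by rewrite /contracted /val1 /val2 /val3; field; rewrite n1 n2 m1 m2 m3 x1.
Qed.

(** The agreement with [contracted_gh] reflects the invariance of Haar measure under inversion; as
    [haar_random] provides left invariance, both values are computed. *)
Lemma contracted_hg : (4 <= d)%N ->
  contracted d (3 / ((D + 1) * (D + 3))) ((D - 1) * (D + 3))^-1 ((D - 1) * (D + 3))^-1 0 =
  2 * D ^+ 2 / (D ^+ 2 - 1).
Proof.
move=> d4; have d0 := ltnW (ltnW (ltnW d4)).
have n1 := natn0 1 d0; have n3 := natn0 3 d0.
have m1 : D - 1 != 0 by apply: (natm0 (k := 1%N)); rewrite gtn_eqF // ltnW // ltnW.
have m2 : D - 2 != 0 by apply: natm0; rewrite gtn_eqF // ltnW.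
have m3 : D - 3 != 0 by apply: natm0; rewrite gtn_eqF.
have x1 : D ^+ 2 - 1 != 0.
  have -> : D ^+ 2 - 1 = (D - 1) * (D + 1) by ring.
  exact: mulf_neq0.
by rewrite /contracted /val1 /val2 /val3; field; rewrite n1 n3 m1 m2 m3 x1.
Qed.

End RationalValues.

(** * The fourth moment of an overlap *)

Section Overlap.
Variables (R : realType) (d : nat).
Local Notation C := R[i].

(** The alternating order matches the slots of [mom B (adj B) B (adj B)]. *)
Lemma abs4E (z : C) : ((abs4 z)%:C)%C = z * z^* * z * z^*.
Proof.
have zz : z * z^* = ((complex.Re z ^+ 2 + complex.Im z ^+ 2)%:C)%C.
  by rewrite -normCK -add_Re2_Im2.
by rewrite -mulrA zz /abs4 rmorphXn.
Qed.

Lemma prod4_sum (F1 F2 F3 F4 : 'I_d -> C) :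
  (\sum_i F1 i) * (\sum_i F2 i) * (\sum_i F3 i) * (\sum_i F4 i) =
  \sum_i \sum_j \sum_k \sum_r F1 i * F2 j * F3 k * F4 r.
Proof.
rewrite !mulr_suml; apply: eq_bigr => i _.
rewrite [F1 i * _]mulr_sumr !mulr_suml; apply: eq_bigr => j _.
rewrite [F1 i * F2 j * _]mulr_sumr !mulr_suml; apply: eq_bigr => k _.
by rewrite mulr_sumr.
Qed.

Lemma mxtrace_diag_mul (l : 'I_d -> C) (M : 'M[C]_d) :
  \tr (diag_mx (\row_i l i) *m M) = \sum_i l i * M i i.
Proof. by apply: eq_bigr => i _; rewrite mul_diag_mx !mxE. Qed.

Lemma adj_diag (l : 'I_d -> C) :
  adj (diag_mx (\row_i l i)) = diag_mx (\row_i (l i)^*) :> 'M[C]_d.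
Proof.
apply/matrixP=> i j; rewrite adjE !mxE eq_sym.
by case: eqVneq => [->|_]; rewrite ?mulr1n ?mulr0n ?rmorph0.
Qed.

Section Spectral.
Variables (S : 'M[C]_d) (l : 'I_d -> C).
Hypothesis uS : unitary S.
Let A := adj S *m diag_mx (\row_i l i) *m S.

Lemma spectral_overlap (M : 'M[C]_d) :
  \tr (adj A *m M) = \sum_i (l i)^* * (S *m M *m adj S) i i.
Proof.
rewrite -mxtrace_diag_mul /A !adj_mul adjK adj_diag !mulmxA.
by rewrite [RHS]mxtrace_mulC !mulmxA.
Qed.

Lemma spectral_trace : \tr A = \sum_i l i.
Proof.
rewrite /A mxtrace_mulC mulmxA unitaryP // mul1mx mxtrace_diag.
by apply: eq_bigr => i _; rewrite mxE.
Qed.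

Lemma spectral_trace_square : \tr (A *m A) = \sum_i l i ^+ 2.
Proof.
rewrite /A -!mulmxA (mulmxA S) unitaryP // mul1mx mxtrace_mulC -!mulmxA unitaryP // mulmx1.
rewrite mxtrace_diag_mul; apply: eq_bigr => i _.
by rewrite !mxE eqxx mulr1n.
Qed.

End Spectral.
End Overlap.

Lemma prod8_rearrange (K : comNzRingType) (a b c e x y z t : K) :
  a * x * (b * y) * (c * z) * (e * t) = a * b * c * e * (x * y * z * t).
Proof. by ring. Qed.

Section FourthMoment.
Variables (R : realType) (d : nat) (dsp : measure_display).
Variables (T : measurableType dsp) (P : probability T R) (U : T -> 'M[R[i]]_d).
Hypothesis haarU : haar_random P U.
Local Notation C := R[i].
Local Notation m B := (conjby U B).
Local Notation mom := (mom P U).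

Lemma overlapE (A B : 'M[C]_d) t :
  \tr (adj A *m U t *m B *m adj (U t)) = \tr (adj A *m conjby U B t).
Proof. by rewrite /conjby !mulmxA. Qed.

Lemma mom_trace0 B1 B2 B3 B4 i j k : \tr B4 = 0 -> \sum_l mom B1 B2 B3 B4 i j k l = 0.
Proof.
move=> tr0.
transitivity (esp P (fun t => \sum_l diag4 (m B1 t) (m B2 t) (m B3 t) (m B4 t) i j k l)).
  apply/esym; apply: (@esp_sum _ _ _ P _ _ _
    (fun l t => diag4 (m B1 t) (m B2 t) (m B3 t) (m B4 t) i j k l)) => l _.
  exact: (bounded_mom haarU B1 B2 B3 B4 i j k l).
rewrite -[RHS](esp_cst P); apply: eq_esp => t.
by rewrite /diag4 -mulr_sumr -/(mxtrace (m B4 t)) (tr_conjby haarU) tr0 mulr0.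
Qed.

Lemma mom_exchangeable B a b g : \tr B = 0 ->
  (forall i, mom B (adj B) B (adj B) i i i i = a /\
     forall j, j != i -> mom B (adj B) B (adj B) i i j j = b /\
                         mom B (adj B) B (adj B) i j i j = g) ->
  exchangeable (mom B (adj B) B (adj B)) a b g.
Proof.
move=> tr0 v; have tr0' : \tr (adj B) = 0 by rewrite mxtrace_adj tr0 rmorph0.
split=> [s i j k l|i j k l|i j k|//].
- exact: mom_perm.
- split; first by rewrite [LHS]mom_swap12 [LHS]mom_swap23 [LHS]mom_swap12.
  by rewrite [LHS]mom_swap23 [LHS]mom_swap34 [LHS]mom_swap23.
- split; first exact: mom_trace0.
  under eq_bigr do rewrite mom_swap34.
  exact: mom_trace0.
Qed.

Lemma esp_overlap4 A B a b g : unitary A -> \tr A = 0 ->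
  exchangeable (mom B (adj B) B (adj B)) a b g ->
  esp P (fun t => ((abs4 (\tr (adj A *m U t *m B *m adj (U t))))%:C)%C) =
  contracted d a b g (\tr (A *m A) * (\tr (A *m A))^*).
Proof.
move=> uA tr0 ex; have [S [l [uS ll AE]]] := unitary_spectral uA.
have l0 : \sum_i l i = 0 by rewrite -(spectral_trace l uS) -AE.
have l'0 : \sum_i (l i)^* = 0 by rewrite -rmorph_sum l0 rmorph0.
have ll' i : (l i)^* * l i = 1 by rewrite mulrC.
have -> : \tr (A *m A) * (\tr (A *m A))^* = (\sum_i l i ^+ 2) * \sum_i (l i)^* ^+ 2.
  rewrite AE (spectral_trace_square l uS) rmorph_sum; congr (_ * _).
  by apply: eq_bigr => i _; rewrite rmorphXn.
rewrite -(contraction ex ll' l0 l'0).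
pose w (M : 'M[C]_d) i := (S *m M *m adj S) i i.
have adjw M i : (w M i)^* = w (adj M) i by rewrite /w -adjE !adj_mul adjK mulmxA.
have z1 M : \tr (adj A *m M) = \sum_i (l i)^* * w M i by rewrite {1}AE spectral_overlap.
have z2 M : (\tr (adj A *m M))^* = \sum_i l i * w (adj M) i.
  by rewrite z1 rmorph_sum; apply: eq_bigr => i _; rewrite rmorphM /= conjCK adjw.
have zE M : \tr (adj A *m M) * (\tr (adj A *m M))^* * \tr (adj A *m M) * (\tr (adj A *m M))^* =
    \sum_i \sum_j \sum_k \sum_r (l i)^* * l j * (l k)^* * l r *
      (w M i * w (adj M) j * w M k * w (adj M) r).
  rewrite z2 z1 prod4_sum; do 4![apply: eq_bigr => ? _].
  exact: prod8_rearrange.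
transitivity (esp P (fun t => \sum_i \sum_j \sum_k \sum_r (l i)^* * l j * (l k)^* * l r *
      (w (m B t) i * w (m (adj B) t) j * w (m B t) k * w (m (adj B) t) r))).
  by apply: eq_esp => t; rewrite overlapE abs4E -(adj_conjby U B t); exact: zE.
have bw (M : T -> 'M[C]_d) i : bounded_rmx M -> bounded_rv (fun t => w (M t) i).
  move=> bM; apply: bounded_rmxM; last exact: bounded_rmx_cst.
  by apply: bounded_rmxM => //; exact: bounded_rmx_cst.
have bwB Q i : bounded_rv (fun t => w (m Q t) i) := bw (m Q) i (bounded_conjby haarU Q).
have b4 i j k r : bounded_rv (fun t =>
    w (m B t) i * w (m (adj B) t) j * w (m B t) k * w (m (adj B) t) r) :=
  bounded_rvM (bounded_rvM (bounded_rvM (bwB B i) (bwB (adj B) j)) (bwB B k)) (bwB (adj B) r).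
(* The eigenbasis [S] of [A] is absorbed by conjugation invariance. *)
have e4 i j k r : esp P (fun t =>
    w (m B t) i * w (m (adj B) t) j * w (m B t) k * w (m (adj B) t) r) =
    mom B (adj B) B (adj B) i j k r.
  exact: (esp_conjby_inv haarU B (adj B) B (adj B) i i j j k k r r uS).
have bc c i j k r := bounded_rvZ c (b4 i j k r).
clear - bc b4 e4; move: (mom _ _ _ _) e4 => M.
pose f i j k r t := w (m B t) i * w (m (adj B) t) j * w (m B t) k * w (m (adj B) t) r.
change ((forall i j k r, esp P (f i j k r) = M i j k r) ->
  esp P (fun t => \sum_i \sum_j \sum_k \sum_r (l i)^* * l j * (l k)^* * l r * f i j k r t) =
  \sum_i \sum_j \sum_k \sum_r (l i)^* * l j * (l k)^* * l r * M i j k r).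
have {}bc c i j k r : bounded_rv (fun t => c * f i j k r t) := bc c i j k r.
have {}b4 i j k r : bounded_rv (f i j k r) := b4 i j k r.
clearbody f => e4.
rewrite esp_sum => [|i _]; last by do 3![apply: bounded_rv_sum => ? _].
apply: eq_bigr => i _; rewrite esp_sum => [|j _]; last by do 2![apply: bounded_rv_sum => ? _].
apply: eq_bigr => j _; rewrite esp_sum => [|k _]; last by apply: bounded_rv_sum => ? _.
apply: eq_bigr => k _; rewrite esp_sum //.
by apply: eq_bigr => r _; rewrite espZ // e4.
Qed.

End FourthMoment.

(** * The expected entropy of a family of operators *)

Section ExpectedEntropy.
Variables (R : realType) (d : nat) (dsp : measure_display).
Variables (T : measurableType dsp) (P : probability T R) (U : T -> 'M[R[i]]_d).
Hypothesis haarU : haar_random P U.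
Local Notation C := R[i].
Local Notation overlap A B t := (\tr (adj A *m U t *m B *m adj (U t))).
Local Notation eoverlap A B := (esp P (fun t => ((abs4 (overlap A B t))%:C)%C)).
Local Notation D := (d%:R : R).

Definition val_hh : R := 3 * D ^+ 2 * (D ^+ 2 - 8) / ((D ^+ 2 - 9) * (D ^+ 2 - 1)).
Definition val_gg : R := 2 * D ^+ 2 * (D ^+ 2 - 3) / ((D ^+ 2 - 4) * (D ^+ 2 - 1)).
Definition val_gh : R := 2 * D ^+ 2 / (D ^+ 2 - 1).

Lemma ord_neq_exists (o : 'I_d) : (2 <= d)%N -> exists p : 'I_d, p != o.
Proof.
move=> d2; have : (0 < #|predC1 o|)%N by rewrite cardC1 card_ord -subn1 subn_gt0.
by move=> /card_gt0P [p]; exists p.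
Qed.

Lemma scalar_square_phase (A : 'M[C]_d) c : (0 < d)%N -> unitary A -> A *m A = c%:M ->
  \tr (A *m A) * (\tr (A *m A))^* = d%:R ^+ 2.
Proof.
move=> d0 uA A2.
have cc : c * c^* = 1.
  have : (A *m A) *m adj (A *m A) = 1%:M.
    by rewrite adj_mul mulmxA -(mulmxA A) unitaryP // mulmx1 unitaryP.
  move=> /matrixP /(_ (Ordinal d0) (Ordinal d0)); rewrite A2 mul_scalar_mx mxE adjE !mxE eqxx.
  by rewrite !mulr1n.
rewrite A2 mxtrace_scalar rmorphMn /= -[c *+ d]mulr_natl -[c^* *+ d]mulr_natl.
by rewrite mulrACA cc mulr1 expr2.
Qed.

Lemma exchangeable_gen B : (2 <= d)%N -> unitary B -> \tr B = 0 -> \tr (B *m B) = 0 ->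
  exchangeable (mom P U B (adj B) B (adj B)) (2 / ((d%:R + 1) * (d%:R + 2)))
    (d%:R / ((d%:R - 1) * (d%:R + 1) * (d%:R + 2))) 0.
Proof.
move=> d2 uB tr0 trB2; apply: mom_exchangeable => // i; split.
  have [p pi] := ord_neq_exists i d2.
  by case: (moments_traceless_square haarU uB tr0 pi trB2).
by move=> j ji; case: (moments_traceless_square haarU uB tr0 ji trB2).
Qed.

Lemma exchangeable_inv B c : (2 <= d)%N -> unitary B -> \tr B = 0 -> B *m B = c%:M ->
  exchangeable (mom P U B (adj B) B (adj B)) (3 / ((d%:R + 1) * (d%:R + 3)))
    ((d%:R - 1) * (d%:R + 3))^-1 ((d%:R - 1) * (d%:R + 3))^-1.
Proof.
move=> d2 uB tr0 B2; apply: mom_exchangeable => // i; split.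
  have [p pi] := ord_neq_exists i d2.
  by case: (moments_scalar_square haarU uB tr0 pi B2).
by move=> j ji; case: (moments_scalar_square haarU uB tr0 ji B2).
Qed.

Section Pair.
Variables A B : 'M[C]_d.
Hypotheses (uA : unitary A) (uB : unitary B) (trA : \tr A = 0) (trB : \tr B = 0).


Lemma eoverlap_hh c c' : (2 <= d)%N -> d != 3%N -> A *m A = c%:M -> B *m B = c'%:M ->
  eoverlap A B = (val_hh%:C)%C.
Proof.
move=> d2 d3 A2 B2; rewrite (esp_overlap4 haarU uA trA (exchangeable_inv d2 uB trB B2)).
rewrite (scalar_square_phase (ltnW d2) uA A2) contracted_hh //.
by rewrite /val_hh !(rmorphM, rmorphB, fmorphV, rmorphXn, rmorph_nat, rmorph1).
Qed.

Lemma eoverlap_gg : (3 <= d)%N -> \tr (A *m A) = 0 -> \tr (B *m B) = 0 ->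
  eoverlap A B = (val_gg%:C)%C.
Proof.
move=> d3 A2 B2; rewrite (esp_overlap4 haarU uA trA (exchangeable_gen (ltnW d3) uB trB B2)).
rewrite A2 mul0r contracted_gg //.
by rewrite /val_gg !(rmorphM, rmorphB, fmorphV, rmorphXn, rmorph_nat, rmorph1).
Qed.

Lemma eoverlap_hg c : (4 <= d)%N -> A *m A = c%:M -> \tr (B *m B) = 0 ->
  eoverlap A B = (val_gh%:C)%C.
Proof.
move=> d4 A2 B2; have d2 := ltnW (ltnW d4).
rewrite (esp_overlap4 haarU uA trA (exchangeable_gen d2 uB trB B2)).
rewrite (scalar_square_phase (ltnW d2) uA A2) contracted_gh //.
by rewrite /val_gh !(rmorphM, rmorphB, fmorphV, rmorphXn, rmorph_nat, rmorph1).
Qed.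

Lemma eoverlap_gh c : (4 <= d)%N -> \tr (A *m A) = 0 -> B *m B = c%:M ->
  eoverlap A B = (val_gh%:C)%C.
Proof.
move=> d4 A2 B2; have d2 := ltnW (ltnW d4).
rewrite (esp_overlap4 haarU uA trA (exchangeable_inv d2 uB trB B2)).
rewrite A2 mul0r contracted_hg //.
by rewrite /val_gh !(rmorphM, rmorphB, fmorphV, rmorphXn, rmorph_nat, rmorph1).
Qed.

End Pair.

Lemma bounded_abs4_overlap A B : bounded_rv (fun t => ((abs4 (overlap A B t))%:C)%C).
Proof.
have bo : bounded_rv (fun t => overlap A B t).
  apply: bounded_rv_sum => i _; apply: bounded_rmxM; last first.
    by apply: bounded_rmx_adj; exact: bounded_haar haarU.
  apply: bounded_rmxM; last exact: bounded_rmx_cst.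
  by apply: bounded_rmxM; [exact: bounded_rmx_cst | exact: bounded_haar haarU].
under eq_fun do rewrite abs4E.
have bo' := bounded_rv_conj bo.
exact: (bounded_rvM (bounded_rvM (bounded_rvM bo bo') bo) bo').
Qed.

Lemma integral_H2 (I : finType) (F : I -> 'M[C]_d) (v : I -> I -> R) :
  (forall a b, eoverlap (F a) (F b) = ((v a b)%:C)%C) ->
  (\int[P]_t (H2 F (U t))%:E)%E = (1 - (d%:R ^+ 6)^-1 * \sum_a \sum_b v a b)%:E.
Proof.
move=> hv; pose f t : C := ((H2 F (U t))%:C)%C.
pose c : R := - (d%:R ^+ 6)^-1.
have fE t : f t = 1 + (c%:C)%C * \sum_a \sum_b ((abs4 (overlap (F a) (F b) t))%:C)%C.
  rewrite /f /H2 rmorphB rmorph1 rmorphM /= /c rmorphN /= mulNr; congr (_ - _ * _).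
  by rewrite rmorph_sum; apply: eq_bigr => a _; rewrite rmorph_sum.
have bs : bounded_rv (fun t => \sum_a \sum_b ((abs4 (overlap (F a) (F b) t))%:C)%C).
  by do 2![apply: bounded_rv_sum => ? _]; exact: bounded_abs4_overlap.
have bf : bounded_rv f.
  rewrite (_ : f = fun t => 1 + (c%:C)%C * \sum_a \sum_b ((abs4 (overlap (F a) (F b) t))%:C)%C).
    by apply: bounded_rvD; [exact: bounded_rv_cst | exact: bounded_rvZ].
  by apply/funext => t; exact: fE.
have -> : (\int[P]_t (H2 F (U t))%:E)%E = (complex.Re (esp P f))%:E by rewrite -integral_Re.
congr (_%:E); suff -> : esp P f = ((1 + c * \sum_a \sum_b v a b)%:C)%C by rewrite /c mulNr.
rewrite (eq_esp P fE) espD ?esp_cst //; last first.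
- exact: bounded_rvZ.
- exact: bounded_rv_cst.
rewrite espZ // rmorphD rmorph1 rmorphM /=; congr (_ + _ * _).
rewrite esp_sum => [|a _]; last by apply: bounded_rv_sum => ? _; exact: bounded_abs4_overlap.
rewrite rmorph_sum; apply: eq_bigr => a _.
rewrite esp_sum => [|b _]; last exact: bounded_abs4_overlap.
by rewrite rmorph_sum; apply: eq_bigr => b _; rewrite hv.
Qed.

Section Family.
Variables (I : finType) (F : I -> 'M[C]_d) (i0 : I) (h : pred I).
Hypotheses (F0 : F i0 = 1%:M) (uF : forall i, unitary (F i)).
Hypothesis (trF : forall i, i != i0 -> \tr (F i) = 0).
Hypothesis (hF : forall i, h i -> exists c, F i *m F i = c%:M).
Hypothesis (gF : forall i, ~~ h i -> \tr (F i *m F i) = 0).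

(** An overlap with the identity [F i0] is a trace, hence 0 against any other member and d^4 in
    fourth power against itself. *)
Let v a b : R :=
  if a == i0 then if b == i0 then d%:R ^+ 4 else 0 else
  if b == i0 then 0 else
  if h a then if h b then val_hh else val_gh else if h b then val_gh else val_gg.

(** Each bound is asked only if operators of that type occur, so that d = 1, with the identity
    alone, and d = 2, with scalar squares alone, fit the same statement. *)
Hypothesis hh_ok : forall i, i != i0 -> h i -> (2 <= d)%N /\ d != 3%N.
Hypothesis gg_ok : forall i, i != i0 -> ~~ h i -> (3 <= d)%N.
Hypothesis gh_ok : forall i j, i != i0 -> j != i0 -> h i -> ~~ h j -> (4 <= d)%N.

Lemma eoverlap_family a b : eoverlap (F a) (F b) = ((v a b)%:C)%C.
Proof.
have e0 b' : eoverlap (F i0) (F b') = ((abs4 (\tr (F b')))%:C)%C.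
  rewrite -[RHS](esp_cst P); apply: eq_esp => t.
  by rewrite F0 adj1 mul1mx (tr_conjby haarU).
have e1 a' : eoverlap (F a') (F i0) = ((abs4 (\tr (adj (F a'))))%:C)%C.
  rewrite -[RHS](esp_cst P); apply: eq_esp => t.
  by rewrite F0 mulmx1 -mulmxA (unitaryP (haar_unitary haarU t)) mulmx1.
have z0 : abs4 (0 : C) = 0 by rewrite /abs4 /= expr0n addr0 expr0n.
rewrite /v; case: (eqVneq a i0) => [->|a0].
  rewrite e0; case: (eqVneq b i0) => [->|b0]; last by rewrite trF // z0.
  by rewrite F0 mxtrace1 abs4E conjC_nat rmorphXn rmorph_nat !exprS expr0 mulr1 !mulrA.
case: (eqVneq b i0) => [->|b0]; first by rewrite e1 mxtrace_adj trF // rmorph0 z0.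
case: ifPn => ha; case: ifPn => hb.
- have [c Ac] := hF ha; have [c' Bc] := hF hb; have [d2 d3] := hh_ok a0 ha.
  exact: (eoverlap_hh (uF a) (uF b) (trF a0) (trF b0) d2 d3 Ac Bc).
- have [c Ac] := hF ha.
  exact: (eoverlap_hg (uF a) (uF b) (trF a0) (trF b0) (gh_ok a0 b0 ha hb) Ac (gF hb)).
- have [c Bc] := hF hb.
  exact: (eoverlap_gh (uF a) (uF b) (trF a0) (trF b0) (gh_ok b0 a0 hb ha) (gF ha) Bc).
- exact: (eoverlap_gg (uF a) (uF b) (trF a0) (trF b0) (gg_ok a0 ha) (gF ha) (gF hb)).
Qed.

Lemma sum_v (m n : nat) : #|[pred i | (i != i0) && h i]| = m ->
  #|[pred i | (i != i0) && ~~ h i]| = n ->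
  \sum_a \sum_b v a b = d%:R ^+ 4 + m%:R ^+ 2 * val_hh + 2 * m%:R * n%:R * val_gh
    + n%:R ^+ 2 * val_gg.
Proof.
move=> cm cn.
have split (f : I -> R) : \sum_i f i = f i0 + \sum_(i | (i != i0) && h i) f i +
    \sum_(i | (i != i0) && ~~ h i) f i.
  by rewrite (bigD1 i0) //= -addrA; congr (_ + _); rewrite (bigID h).
have inner a x y : (forall b, b != i0 -> h b -> v a b = x) ->
    (forall b, b != i0 -> ~~ h b -> v a b = y) ->
    \sum_b v a b = v a i0 + m%:R * x + n%:R * y.
  move=> hx hy; rewrite split -cm -cn; congr (_ + _ + _).
    rewrite (eq_bigr (fun=> x)) => [|b /andP [b0 hb]]; last exact: hx.
    by rewrite sumr_const mulr_natl.
  rewrite (eq_bigr (fun=> y)) => [|b /andP [b0 hb]]; last exact: hy.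
  by rewrite sumr_const mulr_natl.
rewrite split (inner _ 0 0); last 2 first.
- by move=> b b0 _; rewrite /v eqxx (negbTE b0).
- by move=> b b0 _; rewrite /v eqxx (negbTE b0).
rewrite (eq_bigr (fun=> m%:R * val_hh + n%:R * val_gh)); last first.
  move=> a /andP [a0 ha]; rewrite (inner _ val_hh val_gh).
  - by rewrite /v (negbTE a0) eqxx add0r.
  - by move=> b b0 hb; rewrite /v (negbTE a0) (negbTE b0) ha hb.
  - by move=> b b0 hb; rewrite /v (negbTE a0) (negbTE b0) ha (negbTE hb).
rewrite [X in _ + X](eq_bigr (fun=> m%:R * val_gh + n%:R * val_gg)); last first.
  move=> a /andP [a0 ha]; rewrite (inner _ val_gh val_gg).
  - by rewrite /v (negbTE a0) eqxx add0r.
  - by move=> b b0 hb; rewrite /v (negbTE a0) (negbTE b0) (negbTE ha) hb.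
  - by move=> b b0 hb; rewrite /v (negbTE a0) (negbTE b0) (negbTE ha) (negbTE hb).
have em x : \sum_(i | (i != i0) && h i) x = m%:R * x by rewrite sumr_const -cm mulr_natl.
have en x : \sum_(i | (i != i0) && ~~ h i) x = n%:R * x by rewrite sumr_const -cn mulr_natl.
rewrite em en /v !eqxx.
by move: val_hh val_gh val_gg => x y z; ring.
Qed.

Lemma integral_H2_family (m n : nat) : #|[pred i | (i != i0) && h i]| = m ->
  #|[pred i | (i != i0) && ~~ h i]| = n ->
  (\int[P]_t (H2 F (U t))%:E)%E = (1 - (d%:R ^+ 6)^-1 *
    (d%:R ^+ 4 + m%:R ^+ 2 * val_hh + 2 * m%:R * n%:R * val_gh + n%:R ^+ 2 * val_gg))%:E.
Proof. by move=> cm cn; rewrite (integral_H2 eoverlap_family) (sum_v cm cn). Qed.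

End Family.
End ExpectedEntropy.

(** * Displacement operators *)

Section RootsOfUnity.
Variable R : realType.
Local Notation C := R[i].

Lemma expiD (s t : R) : expi (s + t) = expi s * expi t.
Proof. by rewrite /expi cosD sinD; congr Complex; rewrite addrC (mulrC (cos s) (sin t)) addrC. Qed.

Lemma expi_mulrn (t : R) n : expi (t *+ n) = expi t ^+ n.
Proof.
elim: n => [|n IH]; first by rewrite mulr0n expr0 /expi cos0 sin0.
by rewrite mulrS expiD IH exprS.
Qed.

Lemma expi_norm (t : R) : expi t * (expi t)^* = 1.
Proof.
by rewrite -normCK -add_Re2_Im2 /= cos2Dsin2.
Qed.

(** If cos t = 1, the formulas cos t = cos^2 (t/2) - sin^2 (t/2) and cos^2 + sin^2 = 1 force sin
    (t/2) = 0, impossible for 0 < t/2 < pi. *)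
Lemma expi_neq1 (t : R) : 0 < t -> t < 2 * pi -> expi t != 1.
Proof.
move=> t0 t2; apply/eqP => -[c1 _].
have y0 : 0 < t / 2 by rewrite divr_gt0.
have ypi : t / 2 < pi by rewrite ltr_pdivrMr // mulrC.
have s0 : 0 < sin (t / 2) by apply: sin_gt0_pi; rewrite ?in_itv /= y0 ypi.
move: c1; rewrite (splitr t) cosD -!expr2 => c1.
have := cos2Dsin2 (t / 2); rewrite -[in RHS]c1 => /eqP.
rewrite eq_sym subr_eq -addrA -subr_eq0 opprD addrA subrr sub0r oppr_eq0.
by rewrite -mulr2n mulrn_eq0 /= expf_eq0 /= gt_eqF.
Qed.

Variable d : nat.
Hypothesis d0 : (0 < d)%N.
Local Notation w := (omega R d).

Lemma omega_norm : w * w^* = 1. Proof. exact: expi_norm. Qed.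

Lemma tau_norm : tau R d * (tau R d)^* = 1.
Proof. by rewrite /tau rmorphN mulrNN; exact: expi_norm. Qed.

Lemma omega_exp : w ^+ d = 1.
Proof.
rewrite /omega -expi_mulrn -[_ *+ d]mulr_natr divfK ?pnatr_eq0 ?gtn_eqF //.
by rewrite /expi mulr_natl cos2pi mulr2n sinD cospi sinpi !mulr0 !mul0r addr0.
Qed.

Lemma omega_mod k : w ^+ (k %% d) = w ^+ k.
Proof. by rewrite [in RHS](divn_eq k d) exprD mulnC exprM omega_exp expr1n mul1r. Qed.

Lemma omega_neq1 q : (0 < q < d)%N -> w ^+ q != 1.
Proof.
case/andP => q0 qd; rewrite /omega -expi_mulrn; apply: expi_neq1.
  by rewrite pmulrn_rgt0 // divr_gt0 ?ltr0n // mulr_gt0 // pi_gt0.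
rewrite -[_ *+ q]mulr_natr -mulrA gtr_pMr ?mulr_gt0 ?pi_gt0 // mulrC ltr_pdivrMr ?ltr0n //.
by rewrite mul1r ltr_nat.
Qed.

Lemma omega_sum q : (0 < q < d)%N -> \sum_(j < d) w ^+ (j * q) = 0.
Proof.
move=> hq; have := subrX1 (w ^+ q) d.
rewrite -exprM mulnC exprM omega_exp expr1n subrr => /esym/eqP.
rewrite mulf_eq0 subr_eq0 (negbTE (omega_neq1 hq)) /= => /eqP h.
by rewrite -[RHS]h; apply: eq_bigr => j _; rewrite -exprM mulnC.
Qed.

(** X^p Z^q without its phase. Unlike the power of [tau], which has period 2d for even d, it depends
    on p and q modulo d only; natural exponents let products add them freely. *)
Definition weyl p q : 'M[C]_d :=
  \matrix_(i, j) ((val i == (j + p) %% d)%N%:R * w ^+ (j * q)).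

Lemma modn_ord_eq (i j : 'I_d) p : ((i + p) %% d == (j + p) %% d)%N = (i == j).
Proof. by rewrite eqn_modDr !modn_small ?ltn_ord. Qed.

(** Moving Z^q past X^r costs omega^(r q). *)
Lemma weyl_mul p q r s : weyl p q *m weyl r s = w ^+ (r * q) *: weyl (p + r) (q + s).
Proof.
apply/matrixP=> i k; rewrite !mxE.
pose j : 'I_d := Ordinal (ltn_pmod (k + r) d0).
rewrite (bigD1 j) //= big1 => [|j' jj']; last first.
  by rewrite !mxE -[_ == ((k + r) %% d)%N]/(j' == j) (negbTE jj') mul0r mulr0.
rewrite addr0 !mxE /= eqxx mul1r modnDml -addnA (addnC r).
have -> : w ^+ ((k + r) %% d * q) = w ^+ ((k + r) * q).
  by rewrite exprM omega_mod -exprM.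
rewrite mulrCA -mulrA; congr (_ * _); rewrite -!exprD; congr (_ ^+ _).
by rewrite mulnDl mulnDr addnAC addnC.
Qed.

Lemma weyl_mod p q : weyl (p %% d) (q %% d) = weyl p q.
Proof.
apply/matrixP=> i j; rewrite !mxE modnDmr; congr (_ * _).
by rewrite mulnC exprM omega_mod -exprM mulnC.
Qed.

Lemma weyl00 : weyl 0 0 = 1%:M.
Proof.
by apply/matrixP=> i j; rewrite !mxE addn0 modn_small ?ltn_ord // muln0 expr0 mulr1.
Qed.

(** A nonzero shift p leaves the diagonal empty; for p = 0 the trace is a geometric sum of a
    nontrivial root of unity. *)
Lemma weyl_trace p q : ~~ ((p %% d == 0) && (q %% d == 0))%N -> \tr (weyl p q) = 0.
Proof.
rewrite -weyl_mod; move: (ltn_pmod p d0) (ltn_pmod q d0).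
move: (p %% d)%N (q %% d)%N => {}p {}q pd qd; rewrite /mxtrace.
case: (eqVneq p 0%N) => [->|p0] /= h.
  under eq_bigr => j _ do rewrite mxE addn0 modn_small ?ltn_ord // eqxx mul1r.
  by apply: omega_sum; rewrite lt0n h.
rewrite big1 // => j _; rewrite mxE; have : (0 %% d != p %% d)%N.
  by rewrite mod0n modn_small // eq_sym.
by rewrite -(eqn_modDl j) addn0 (modn_small (ltn_ord j)) => /negbTE ->; rewrite mul0r.
Qed.

Lemma weyl_unitary p q : unitary (weyl p q).
Proof.
apply/eqP; apply: mulmx1C; apply/matrixP=> j k; rewrite mxE.
pose i : 'I_d := Ordinal (ltn_pmod (j + p) d0).
rewrite (bigD1 i) //= big1 => [|i' ii']; last first.
  by rewrite adjE !mxE -[_ == ((j + p) %% d)%N]/(i' == i) (negbTE ii') mul0r rmorph0 mul0r.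
rewrite addr0 adjE !mxE /= eqxx mul1r modn_ord_eq; case: eqVneq => [->|_].
  by rewrite mul1r mulrC rmorphXn -exprMn omega_norm expr1n.
by rewrite mul0r mulr0.
Qed.

Lemma mxpow_Xop k : mxpow (Xop R d) k = weyl k 0.
Proof.
elim: k => [|k IH]; first by rewrite weyl00.
rewrite /mxpow iterS -/(mxpow _ _) IH.
have -> : Xop R d = weyl 1 0.
  by apply/matrixP=> i j; rewrite !mxE muln0 expr0 mulr1 addn1.
by rewrite weyl_mul muln0 expr0 scale1r add1n.
Qed.

Lemma mxpow_Zop k : mxpow (Zop R d) k = weyl 0 k.
Proof.
elim: k => [|k IH]; first by rewrite weyl00.
rewrite /mxpow iterS -/(mxpow _ _) IH.
have -> : Zop R d = weyl 0 1.
  by apply/matrixP=> i j; rewrite !mxE muln1 addn0 modn_small ?ltn_ord.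
by rewrite weyl_mul mul0n expr0 scale1r add1n.
Qed.

Lemma dispE (a : 'I_d * 'I_d) : disp R a = tau R d ^+ (a.1 * a.2) *: weyl a.1 a.2.
Proof.
by rewrite /disp mxpow_Xop mxpow_Zop weyl_mul mul0n expr0 scale1r addn0.
Qed.

Lemma disp_unitary (a : 'I_d * 'I_d) : unitary (disp R a).
Proof.
rewrite dispE; apply/eqP; rewrite adj_scale -scalemxAl -scalemxAr scalerA.
by rewrite unitaryP ?weyl_unitary // rmorphXn -exprMn tau_norm expr1n scale1r.
Qed.

Definition disp_zero : 'I_d * 'I_d := (Ordinal d0, Ordinal d0).

Lemma disp0 : disp R disp_zero = 1%:M.
Proof. by rewrite dispE expr0 scale1r weyl00. Qed.

Lemma disp_trace (a : 'I_d * 'I_d) : a != disp_zero -> \tr (disp R a) = 0.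
Proof.
move=> a0; rewrite dispE mxtraceZ weyl_trace ?mulr0 //.
by case: a a0 => a1 a2; rewrite xpair_eqE /= !modn_small ?ltn_ord.
Qed.

Definition two_torsion (a : 'I_d * 'I_d) : bool :=
  ((a.1 + a.1) %% d == 0)%N && ((a.2 + a.2) %% d == 0)%N.

Lemma disp_square (a : 'I_d * 'I_d) : exists c, disp R a *m disp R a =
  c *: weyl (a.1 + a.1) (a.2 + a.2).
Proof.
by rewrite dispE -scalemxAl -scalemxAr weyl_mul !scalerA; eexists; reflexivity.
Qed.

Lemma disp_square_torsion (a : 'I_d * 'I_d) : two_torsion a ->
  exists c, disp R a *m disp R a = c%:M.
Proof.
case/andP => /eqP h1 /eqP h2; have [c ->] := disp_square a; exists c.
by rewrite -weyl_mod h1 h2 weyl00 scalemx1.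
Qed.

Lemma disp_square_trace (a : 'I_d * 'I_d) : ~~ two_torsion a ->
  \tr (disp R a *m disp R a) = 0.
Proof. by move=> h; have [c ->] := disp_square a; rewrite mxtraceZ weyl_trace ?mulr0. Qed.

End RootsOfUnity.

(** * Tensor products of qubit operators *)

Section Qubits.
Variables (R : realType) (n : nat).
Local Notation C := R[i].

Lemma bits_inj m (x y : nat) : (x < 2 ^ m)%N -> (y < 2 ^ m)%N ->
  (forall k, (k < m)%N -> (x %/ 2 ^ k %% 2 = y %/ 2 ^ k %% 2)%N) -> x = y.
Proof.
elim: m x y => [|m IH] x y; first by rewrite expn0 !ltnS !leqn0 => /eqP -> /eqP ->.
rewrite expnSr => xm ym h.
rewrite (divn_eq x 2) (divn_eq y 2); congr (_ * 2 + _)%N; last first.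
  by have := h 0%N isT; rewrite expn0 !divn1.
apply: IH; rewrite ?ltn_divLR // => k km.
by rewrite -!divnMA -expnS; exact: h.
Qed.

Lemma val_bit k (i : 'I_(2 ^ n)) : bit k i = (i %/ 2 ^ k %% 2)%N :> nat.
Proof. by rewrite /bit inordK // ltn_mod. Qed.

Definition bits (i : 'I_(2 ^ n)) : {ffun 'I_n -> 'I_2} := [ffun k : 'I_n => bit k i].

Lemma bits_injective : injective bits.
Proof.
move=> i j /ffunP e; apply: val_inj; apply: (@bits_inj n); try exact: ltn_ord.
by move=> k kn; have := e (Ordinal kn); rewrite !ffunE => /(congr1 (@nat_of_ord 2)); rewrite !val_bit.
Qed.

Lemma bits_bij : bijective bits.
Proof. by apply: (inj_card_bij bits_injective); rewrite card_ffun !card_ord. Qed.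

(** Binary digits identify the indices below 2^n with bit strings, over which the product
    distributes; products and traces of [tens] thereby factor over qubits. *)
Lemma sum_bits (G : 'I_n -> 'I_2 -> C) :
  \sum_(i < 2 ^ n) \prod_(k < n) G k (bit k i) = \prod_(k < n) \sum_x G k x.
Proof.
rewrite bigA_distr_bigA (reindex bits) /=; last exact: onW_bij bits_bij.
by apply: eq_bigr => i _; apply: eq_bigr => k _; rewrite ffunE.
Qed.

Definition tens (M : 'I_n -> 'M[C]_2) : 'M[C]_(2 ^ n) :=
  \matrix_(i, j) \prod_(k < n) M k (bit k i) (bit k j).

Lemma tens_mul M N : tens M *m tens N = tens (fun k => M k *m N k).
Proof.
apply/matrixP=> i j; rewrite !mxE.
transitivity (\sum_(l < 2 ^ n) \prod_(k < n) (M k (bit k i) (bit k l) * N k (bit k l) (bit k j))).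
  by apply: eq_bigr => l _; rewrite !mxE big_split.
rewrite (sum_bits (fun k x => M k (bit k i) x * N k x (bit k j))).
by apply: eq_bigr => k _; rewrite mxE.
Qed.

Lemma tens_adj M : adj (tens M) = tens (fun k => adj (M k)).
Proof.
apply/matrixP=> i j; rewrite adjE !mxE rmorph_prod.
by apply: eq_bigr => k _; rewrite adjE.
Qed.

Lemma tens_scalar (c : 'I_n -> C) : tens (fun k => (c k)%:M) = (\prod_k c k)%:M.
Proof.
apply/matrixP=> i j; rewrite !mxE; case: eqVneq => [->|ij].
  by rewrite mulr1n; apply: eq_bigr => k _; rewrite mxE eqxx mulr1n.
have [k bk] : exists k, bits i k != bits j k.
  apply/existsP; apply: contraNT ij; rewrite negb_exists => /forallP h.
  by apply/eqP/bits_injective/ffunP => k; apply/eqP; have := h k; rewrite negbK.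
rewrite mulr0n (bigD1 k) //= mxE; move: bk; rewrite !ffunE => /negbTE ->.
by rewrite mulr0n mul0r.
Qed.

Lemma tens1 : tens (fun=> 1%:M) = 1%:M.
Proof. by rewrite tens_scalar big1. Qed.

Lemma tens_trace M : \tr (tens M) = \prod_k \tr (M k).
Proof.
rewrite -(sum_bits (fun k x => M k x x)).
by apply: eq_bigr => i _; rewrite mxE.
Qed.

Lemma eq_tens M N : M =1 N -> tens M = tens N.
Proof. by move=> /funext ->. Qed.

Lemma dispnE (a : {ffun 'I_n -> 'I_2 * 'I_2}) : dispn R a = tens (fun k => disp R (a k)).
Proof. by []. Qed.

Definition dispn_zero : {ffun 'I_n -> 'I_2 * 'I_2} := [ffun=> disp_zero (ltn0Sn 1)].

Lemma dispn0 : dispn R dispn_zero = 1%:M.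
Proof. by rewrite dispnE -tens1; apply: eq_tens => k; rewrite ffunE disp0. Qed.

Lemma dispn_unitary (a : {ffun 'I_n -> 'I_2 * 'I_2}) : unitary (dispn R a).
Proof.
apply/eqP; rewrite dispnE tens_adj tens_mul -tens1; apply: eq_tens => k.
by apply: unitaryP; exact: disp_unitary.
Qed.

Lemma dispn_trace (a : {ffun 'I_n -> 'I_2 * 'I_2}) : a != dispn_zero -> \tr (dispn R a) = 0.
Proof.
move=> a0; have [k ak] : exists k, a k != dispn_zero k.
  apply/existsP; apply: contraNT a0; rewrite negb_exists => /forallP h.
  by apply/eqP/ffunP => k; apply/eqP; have := h k; rewrite negbK.
rewrite dispnE tens_trace (bigD1 k) //= (@disp_trace R 2 (ltn0Sn 1)) ?mul0r //.
by move: ak; rewrite ffunE.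
Qed.

(** Every point is two-torsion modulo 2, so all n-qubit operators are of the scalar-square type. *)
Lemma dispn_square (a : {ffun 'I_n -> 'I_2 * 'I_2}) : exists c, dispn R a *m dispn R a = c%:M.
Proof.
have h k : exists c, disp R (a k) *m disp R (a k) = c%:M.
  apply: disp_square_torsion => //.
  by rewrite /two_torsion !addnn -!muln2 !modnMl.
have [c hc] := choice h; exists (\prod_k c k).
by rewrite dispnE tens_mul -tens_scalar; exact: eq_tens.
Qed.

End Qubits.

(** * The three entropies *)

Section Counting.
Variable d : nat.
Hypothesis d0 : (0 < d)%N.
Local Notation i0 := (disp_zero d0).

Lemma two_torsion0 : two_torsion i0.
Proof. by rewrite /two_torsion /= mod0n. Qed.

(** The successor accounts for the origin, which is a torsion point and indexes the identity. *)
Lemma card_torsion m : #|[pred a : 'I_d * 'I_d | two_torsion a]| = m.+1 ->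
  #|[pred a | (a != i0) && two_torsion a]| = m /\
  #|[pred a | (a != i0) && ~~ two_torsion a]| = (d ^ 2 - m.+1)%N.
Proof.
move=> cm; split.
  have := cardD1 i0 [pred a : 'I_d * 'I_d | two_torsion a].
  by rewrite cm inE two_torsion0 add1n => -[->]; apply: eq_card => a; rewrite !inE.
have := cardC [pred a : 'I_d * 'I_d | two_torsion a].
rewrite cm card_prod card_ord mulnn => <-; rewrite addKn.
apply: eq_card => a; rewrite !inE; case: eqVneq => //= ->.
by rewrite two_torsion0.
Qed.

Lemma card_two_torsion (A : pred 'I_d) : (forall x : 'I_d, ((x + x) %% d == 0)%N = A x) ->
  #|[pred a : 'I_d * 'I_d | two_torsion a]| = (#|A| ^ 2)%N.
Proof.
move=> hA; rewrite -mulnn -cardX; apply: eq_card => -[x y].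
by rewrite !inE /two_torsion /= !hA.
Qed.

Lemma card_torsion_odd : odd d -> #|[pred a : 'I_d * 'I_d | two_torsion a]| = 1%N.
Proof.
move=> od; rewrite (@card_two_torsion (pred1 (Ordinal d0))) ?card1 // => x.
rewrite addnn -muln2 -/(dvdn d (x * 2)) Gauss_dvdl ?coprimen2 //.
by rewrite /dvdn modn_small // -val_eqE.
Qed.

(** Each coordinate has the two solutions 0 and d/2 of 2 x = 0. *)
Lemma card_torsion_even : ~~ odd d -> #|[pred a : 'I_d * 'I_d | two_torsion a]| = 4%N.
Proof.
move=> ed; have dE : d = (d./2 * 2)%N by rewrite muln2 even_halfK.
have k0 : (0 < d./2)%N by move: d0; rewrite {1}dE muln_gt0 => /andP [].
have kd : (d./2 < d)%N by rewrite {2}dE ltn_Pmulr.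
rewrite (@card_two_torsion (pred2 (Ordinal d0) (Ordinal kd))).
  by rewrite card2 -val_eqE /= neq_ltn k0.
move=> x; rewrite addnn -muln2.
have -> : ((x * 2) %% d = (x %% d./2) * 2)%N by rewrite muln_modl -dE.
rewrite muln_eq0 orbF /= -!val_eqE /=.
have [xk|kx] := ltnP x d./2; first by rewrite modn_small // (ltn_eqF xk) orbF.
have e : (x = (x - d./2) + d./2 :> nat)%N by rewrite subnK.
have xs : (x - d./2 < d./2)%N by rewrite ltn_subLR // addnn -muln2 -dE.
rewrite {1}e modnDr modn_small // subn_eq0 (gtn_eqF (leq_trans k0 kx)) /=.
by rewrite eqn_leq kx andbT.
Qed.

End Counting.

(** At d = 1 the factor d^2 - 1, which counts the operators other than the identity, cannot be
    cancelled against the denominator, so both sides are evaluated directly. *)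
Lemma entropy_odd_value (R : realFieldType) (d : R) :
  d != 0 -> d ^+ 2 - 4 != 0 -> d ^+ 2 - 1 = 0 \/ d ^+ 2 - 1 != 0 ->
  1 - (d ^+ 6)^-1 * (d ^+ 4 + (d ^+ 2 - 1) ^+ 2 *
     (2 * d ^+ 2 * (d ^+ 2 - 3) / ((d ^+ 2 - 4) * (d ^+ 2 - 1)))) =
  1 - 3 * (d ^+ 4 - 4 * d ^+ 2 + 2) / (d ^+ 4 * (d ^+ 2 - 4)).
Proof.
move=> d0 d4 [e|d1]; last by field; rewrite d0 d4 d1.
have e2 : d ^+ 2 = 1 by apply/eqP; rewrite -subr_eq0 e.
rewrite e expr0n /= mul0r addr0.
have -> : d ^+ 6 = (d ^+ 2) ^+ 3 by ring.
have -> : d ^+ 4 = (d ^+ 2) ^+ 2 by ring.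
by rewrite e2; field.
Qed.

Lemma entropy_qubits_value (R : realFieldType) (d : R) :
  d != 0 -> d ^+ 2 - 9 != 0 -> d ^+ 2 - 1 = 0 \/ d ^+ 2 - 1 != 0 ->
  1 - (d ^+ 6)^-1 * (d ^+ 4 + (d ^+ 2 - 1) ^+ 2 *
     (3 * d ^+ 2 * (d ^+ 2 - 8) / ((d ^+ 2 - 9) * (d ^+ 2 - 1)))) =
  1 - 4 * (d ^+ 4 - 9 * d ^+ 2 + 6) / (d ^+ 4 * (d ^+ 2 - 9)).
Proof.
move=> d0 d4 [e|d1]; last by field; rewrite d0 d4 d1.
have e2 : d ^+ 2 = 1 by apply/eqP; rewrite -subr_eq0 e.
rewrite e expr0n /= mul0r addr0.
have -> : d ^+ 6 = (d ^+ 2) ^+ 3 by ring.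
have -> : d ^+ 4 = (d ^+ 2) ^+ 2 by ring.
by rewrite e2; field.
Qed.

(** The 3 counts the nonzero two-torsion points and d^2 - 4 the remaining operators; at d = 2 the
    latter are absent and d^2 - 4 cannot be cancelled. *)
Lemma entropy_even_value (R : realFieldType) (d : R) :
  d != 0 -> d ^+ 2 - 9 != 0 -> d ^+ 2 - 1 != 0 -> d ^+ 2 - 4 = 0 \/ d ^+ 2 - 4 != 0 ->
  1 - (d ^+ 6)^-1 * (d ^+ 4 + 3 ^+ 2 *
      (3 * d ^+ 2 * (d ^+ 2 - 8) / ((d ^+ 2 - 9) * (d ^+ 2 - 1))) +
      2 * 3 * (d ^+ 2 - 4) * (2 * d ^+ 2 / (d ^+ 2 - 1)) +
      (d ^+ 2 - 4) ^+ 2 * (2 * d ^+ 2 * (d ^+ 2 - 3) / ((d ^+ 2 - 4) * (d ^+ 2 - 1)))) =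
  1 - 3 * (d ^+ 4 - 10 * d ^+ 2 + 10) / (d ^+ 2 * (d ^+ 2 - 9) * (d ^+ 2 - 1)).
Proof.
move=> d0 d9 d1 [e|d4]; last by field; rewrite d0 d9 d1 d4.
have e2 : d ^+ 2 = 4 by apply/eqP; rewrite -subr_eq0 e.
rewrite e expr0n /= mulr0 !mul0r !addr0.
have -> : d ^+ 6 = (d ^+ 2) ^+ 3 by ring.
have -> : d ^+ 4 = (d ^+ 2) ^+ 2 by ring.
by rewrite e2; field.
Qed.

Lemma natr_sq_sub_neq0 (R : realFieldType) (d k : nat) : d != k ->
  (d%:R ^+ 2 - (k ^ 2)%:R : R) != 0.
Proof. by rewrite subr_eq0 -natrX eqr_nat eqn_exp2r. Qed.

Lemma eq0_or (R : realFieldType) (x : R) : x = 0 \/ x != 0.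
Proof. by case: (eqVneq x 0); [left | right]. Qed.

Theorem theorem8 :
  (* (i) odd d, single qudit (n = 1, d_L = d) *)
  (forall (R : realType) (d : nat) (dsp : measure_display) (T : measurableType dsp)
     (P : probability T R) (U : T -> 'M[R[i]]_d),
     odd d -> haar_random P U ->
     (\int[P]_t (H2 (@disp R d) (U t))%:E)%E =
       (1 - 3%:R * (d%:R ^+ 4 - 4%:R * d%:R ^+ 2 + 2%:R)
              / (d%:R ^+ 4 * (d%:R ^+ 2 - 4%:R)) : R)%:E) /\
  (* (ii) even d, single qudit (n = 1, d_L = d) *)
  (forall (R : realType) (d : nat) (dsp : measure_display) (T : measurableType dsp)
     (P : probability T R) (U : T -> 'M[R[i]]_d),
     (0 < d)%N -> ~~ odd d -> haar_random P U ->
     (\int[P]_t (H2 (@disp R d) (U t))%:E)%E =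
       (1 - 3%:R * (d%:R ^+ 4 - 10%:R * d%:R ^+ 2 + 10%:R)
              / (d%:R ^+ 2 * (d%:R ^+ 2 - 9%:R) * (d%:R ^+ 2 - 1)) : R)%:E) /\
  (* (iii) d = 2^n, n-qubit displacement operators (d_L = 2) *)
  (forall (R : realType) (n : nat) (dsp : measure_display) (T : measurableType dsp)
     (P : probability T R) (U : T -> 'M[R[i]]_(2 ^ n)),
     haar_random P U ->
     (\int[P]_t (H2 (@dispn R n) (U t))%:E)%E =
       (1 - 4%:R * ((2 ^ n)%:R ^+ 4 - 9%:R * (2 ^ n)%:R ^+ 2 + 6%:R)
              / ((2 ^ n)%:R ^+ 4 * ((2 ^ n)%:R ^+ 2 - 9%:R)) : R)%:E).
Proof.
split; [|split].
- move=> R d dsp T P U od haarU.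
  have d0 : (0 < d)%N by case: d od {U haarU}.
  have [c1 c2] := card_torsion d0 (card_torsion_odd d0 od).
  have no a : a != disp_zero d0 -> two_torsion a -> False.
    by move=> a0 ta; move/card0_eq: c1 => /(_ a); rewrite !inE a0 ta.
  (* For d = 1 the origin is the only index; any other odd d is at least 3. *)
  have d_gt3 a : a != disp_zero d0 -> (3 <= d)%N.
    move=> a0; case: d od d0 a a0 {U haarU c1 c2 no} => [|[|[|d]]] // _ d0 [a1 a2].
    by rewrite xpair_eqE !(ord1 a1) (ord1 a2) !ord1 eqxx.
  rewrite (integral_H2_family haarU (disp0 R d0) (disp_unitary R d0) (@disp_trace R d d0)
    (disp_square_torsion R d0) (disp_square_trace R d0) _ _ _ c1 c2).
  + congr (_%:E); rewrite /val_gg expr0n /= mul0r mulr0 !mul0r !addr0 natrB ?expn_gt0 ?d0 //.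
    rewrite natrX; apply: entropy_odd_value; last exact: eq0_or.
      by rewrite pnatr_eq0 -lt0n.
    by apply: (natr_sq_sub_neq0 R (k := 2%N)); case: eqVneq od => // ->.
  + by move=> a a0 /(no a a0).
  + by move=> a a0 _; exact: d_gt3 a0.
  + by move=> a b a0 _ /(no a a0).
- move=> R d dsp T P U d0 ed haarU.
  have d2 : (2 <= d)%N by case: d d0 ed {U haarU} => [|[]].
  have [c1 c2] := card_torsion d0 (card_torsion_even d0 ed).
  (* At d = 2 every point is two-torsion, so a point that is not forces the even number d to be at
     least 4. *)
  have four (a : 'I_d * 'I_d) : ~~ two_torsion a -> (4 <= d)%N.
    move=> nt; have : (d != 2)%N.
      apply: contraNneq nt => e.
      have h (x : nat) : ((x + x) %% d == 0)%N by rewrite e addnn -muln2 modnMl.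
      by apply/andP; split; exact: h.
    by clear - d2 ed; case: d d2 ed => [|[|[|[|d]]]].
  rewrite (integral_H2_family haarU (disp0 R d0) (disp_unitary R d0) (@disp_trace R d d0)
    (disp_square_torsion R d0) (disp_square_trace R d0) _ _ _ c1 c2).
  + congr (_%:E); rewrite /val_hh /val_gg /val_gh natrB ?(leq_exp2r 2) ?(@leq_exp2r 2 d 2) //.
    rewrite natrX; apply: entropy_even_value; last exact: eq0_or.
    * by rewrite pnatr_eq0 -lt0n.
    * by apply: (natr_sq_sub_neq0 R (k := 3%N)); apply: contraNneq ed => ->.
    * by apply: (natr_sq_sub_neq0 R (k := 1%N)); apply: contraNneq ed => ->.
  + by move=> a a0 _; split=> //; apply: contraNneq ed => ->.
  + by move=> a a0 /(four a) /ltnW.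
  + by move=> a b a0 b0 _ /(four b).
- move=> R n dsp T P U haarU.
  have d3 : (2 ^ n != 3)%N.
    by case: n {U haarU} => // n; apply/eqP => /(congr1 odd); rewrite expnS oddM.
  have c1 : #|[pred a | (a != dispn_zero n) && predT a]| = ((2 ^ n) ^ 2 - 1)%N.
    have := cardC1 (dispn_zero n); rewrite card_ffun card_prod !card_ord => h.
    rewrite -[LHS](eq_card (A := predC1 (dispn_zero n))) => [|a]; last by rewrite !inE andbT.
    by rewrite h -subn1 expnMn mulnn.
  have c2 : #|[pred a | (a != dispn_zero n) && ~~ predT a]| = 0%N.
    by apply: eq_card0 => a; rewrite !inE andbF.
  rewrite (integral_H2_family haarU (dispn0 R n) (@dispn_unitary R n) (@dispn_trace R n)
    (h := predT) (fun a _ => dispn_square R a) _ _ _ _ c1 c2) //.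
  + congr (_%:E); rewrite /val_hh !mulr0 expr0n /= !mul0r !addr0 natrB ?expn_gt0 //.
    have -> : ((2 ^ n) ^ 2)%:R = (2 ^ n)%:R ^+ 2 :> R by rewrite -natrX.
    apply: entropy_qubits_value; last exact: eq0_or.
      by rewrite pnatr_eq0 expn_eq0.
    exact: (natr_sq_sub_neq0 R (k := 3%N)).
  + move=> a a0 _; split=> //; case: n a a0 {U haarU d3 c1 c2} => [|n] a a0.
      by case/eqP: a0; apply/ffunP => -[].
    by rewrite expnS leq_pmulr // expn_gt0.
Qed.
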